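(* Let $n,m,s\ge 2$ and let $NI(G_1^2)\subset S=K[V(G_1)]$ be the closed neighborhood ideal of the square of the double broom graph $G_1=B(n,m,s)$ on the vertex set $V(G_1)=\{x_1,\ldots,x_n,y_1,\ldots,y_m,z_1,\ldots,z_s\}$. Then $NI(G_1^2)$ is Cohen--Macaulay if and only if $m=4$.
   Context: $K$ is a field. For $n,m,s\ge 2$, the double broom graph $G_1=B(n,m,s)$ is the simple graph with vertex set $V(G_1)=\{x_1,\ldots,x_n,y_1,\ldots,y_m,z_1,\ldots,z_s\}$ and edge set $E(G_1)=\{\{x_i,y_1\}:1\le i\le n\}\cup\{\{y_j,y_{j+1}\}:1\le j\le m-1\}\cup\{\{y_m,z_r\}:1\le r\le s\}$. Its square $G_1^2$ is the graph on the same vertex set with edge set $E(G_1^2)=E(G_1)\cup\{\{x_i,x_j\}:1\le i<j\le n\}\cup\{\{x_i,y_2\}:1\le i\le n\}\cup\{\{y_j,y_{j+2}\}:1\le j\le m-2\}\cup\{\{y_{m-1},z_r\}:1\le r\le s\}\cup\{\{z_r,z_h\}:1\le r<h\le s\}$. For a simple graph $H$ and a vertex $u$, the closed neighborhood is $N[u]=\{u\}\cup\{v:\{u,v\}\in E(H)\}$. The closed neighborhood ideal $NI(H)$ is the squarefree monomial ideal of the polynomial ring $K[V(H)]$ (whose variables are the vertices) generated by the monomials $\prod_{v\in N[u]}v$, for $u\in V(H)$. An ideal $I\subset S$ is called Cohen--Macaulay if the quotient ring $S/I$ is Cohen--Macaulay. *)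

(* Defs.v *)
From HB Require Import structures.
From mathcomp Require Import all_boot all_order all_algebra.
From mathcomp Require Import boolp.
From mathcomp Require Import mpoly.
From mathcomp Require Import zify.

Set Implicit Arguments.
Unset Strict Implicit.
Unset Printing Implicit Defensive.

Import GRing.Theory.

Local Open Scope ring_scope.

(* Ideals are boolean predicates, as in ring_quotient; since the membership   *)
(* tests below are given by [asbool], these stand for arbitrary subsets.      *)
(* Note that [idealr_closed I] includes [1 \notin I].                         *)

Section CohenMacaulay.
Variable R : comNzRingType.
Implicit Types (I P : {pred R}) (s : seq R).

Definition gen_ideal s : {pred R} :=
  fun r => `[< exists c : 'I_(size s) -> R, r = \sum_(i < size s) c i * s`_i >].

Definition noetherian : Prop :=
  forall I, idealr_closed I -> exists s, I =i gen_ideal s.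

Definition prime_ideal P : Prop := idealr_closed P /\ prime_idealr_closed P.

Definition maximal_ideal P : Prop :=
  idealr_closed P /\
  forall I, idealr_closed I -> {subset P <= I} -> {subset I <= P}.

Definition regular_sequence s : Prop :=
  1 \notin gen_ideal s /\
  forall i r, (i < size s)%N ->
    s`_i * r \in gen_ideal (take i s) -> r \in gen_ideal (take i s).

(* P_0 < P_1 < ... < P_k = P *)
Definition prime_chain P k : Prop :=
  exists Q : nat -> {pred R},
    [/\ forall i, (i <= k)%N -> prime_ideal (Q i),
        forall i, (i < k)%N ->
          {subset Q i <= Q i.+1} /\ ~ {subset Q i.+1 <= Q i}
      & Q k =i P].

Definition has_height P d : Prop :=
  prime_chain P d /\ forall k, prime_chain P k -> (k <= d)%N.

(* depth (or grade) of P on R: the maximal length of an R-sequence in P *)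
Definition has_depth P d : Prop :=
  (exists s, [/\ size s = d, {subset s <= P} & regular_sequence s]) /\
  forall s, {subset s <= P} -> regular_sequence s -> (size s <= d)%N.

(* A Noetherian ring with depth P = height P for each maximal ideal P; see    *)
(* Eisenbud, "Commutative Algebra with a View Toward Algebraic Geometry",     *)
(* Section 18.2.                                                              *)
Definition cohen_macaulay : Prop :=
  noetherian /\
  forall P, maximal_ideal P -> exists d, has_depth P d /\ has_height P d.

End CohenMacaulay.

Arguments cohen_macaulay R : clear implicits.

Definition cohen_macaulay_ideal (R : comNzRingType) (I : idealr R) : Prop :=
  cohen_macaulay {ideal_quot I}.

Lemma gen_ideal_linear (R : comNzRingType) (s : seq R) :
  forall a, {in gen_ideal s &, forall u v, a * u + v \in gen_ideal s}.
Proof.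
move=> a _ _ /asboolP[c ->] /asboolP[d ->]; apply/asboolP.
exists (fun i => a * c i + d i); rewrite mulr_sumr -big_split /=.
by apply: eq_bigr => i _; rewrite mulrDl mulrA.
Qed.

(* A simple graph on the finite vertex set V is given by its adjacency        *)
(* relation; the variable of K[V] attached to v is 'X_(enum_rank v).          *)

Definition closed_neighborhood (V : finType) (e : rel V) (u : V) : {set V} :=
  u |: [set v | e u v].

Section ClosedNeighborhoodIdeal.
Variables (K : fieldType) (V : finType) (e : rel V).

Definition nbhd_monomial (u : V) : {mpoly K[#|V|]} :=
  \prod_(v in closed_neighborhood e u) 'X_(enum_rank v).

Definition NI : {pred {mpoly K[#|V|]}} :=
  gen_ideal [seq nbhd_monomial u | u <- enum V].

Lemma NI_idealr_closed : idealr_closed NI.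
Proof.
split; last exact: gen_ideal_linear.
  apply/asboolP; exists (fun=> 0).
  by rewrite big1 // => i _; rewrite mul0r.
apply/asboolP => -[c] /(congr1 (fun p : {mpoly K[#|V|]} => p.@[fun=> 0])).
rewrite rmorph1 rmorph_sum big1 => [/eqP|i _]; first by rewrite oner_eq0.
rewrite rmorphM; have /mapP[u _ ->] := mem_nth 0 (ltn_ord i).
rewrite /nbhd_monomial (bigD1 u) ?setU11 //=.
by rewrite rmorphM /= mevalXU mul0r mulr0.
Qed.

HB.instance Definition _ :=
  isIdealr.Build {mpoly K[#|V|]} NI NI_idealr_closed.

End ClosedNeighborhoodIdeal.

Arguments NI K {V} e.

Section DoubleBroom.
Variables n m s : nat.

(* x_1..x_n, y_1..y_m and z_1..z_s, with indices shifted to start at 0 *)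
Definition broom_vertex : finType := ('I_n + ('I_m + 'I_s))%type.

Notation x i := (inl i).
Notation y j := (inr (inl j)).
Notation z r := (inr (inr r)).

Definition double_broom_arc (u v : broom_vertex) : bool :=
  match u, v with
  | x _, y j => j == 0%N :> nat
  | y j, y k => k == j.+1 :> nat
  | y j, z _ => j.+1 == m
  | _, _ => false
  end.

Definition double_broom : rel broom_vertex :=
  fun u v => double_broom_arc u v || double_broom_arc v u.

Definition double_broom_square_arc (u v : broom_vertex) : bool :=
  match u, v with
  | x i, x j => (i < j)%N
  | x _, y j => j == 1%N :> nat
  | y j, y k => k == j.+2 :> nat
  | y j, z _ => j.+2 == m
  | z r, z h => (r < h)%N
  | _, _ => false
  end.

Definition double_broom_square : rel broom_vertex :=
  fun u v => [|| double_broom u v, double_broom_square_arc u v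
               | double_broom_square_arc v u].

(* the edges listed above are those joining vertices at distance 1 or 2 *)
Lemma double_broom_squareP (u v : broom_vertex) :
  (2 <= m)%N ->
  double_broom_square u v =
    (u != v) &&
    (double_broom u v || [exists w, double_broom u w && double_broom w v]).
Proof.
move=> m2; have m0 : (0 < m)%N by apply: leq_trans m2.
have mP : (m.-1 < m)%N by rewrite prednK.
have wY a b j : double_broom a (y j) && double_broom (y j) b ->
    [exists w, double_broom a w && double_broom w b].
  by move=> h; apply/existsP; exists (y j).
apply/idP/idP; rewrite /double_broom_square.
- have ne_edge a b : double_broom a b -> a != b.
    apply: contraTneq => ->; rewrite /double_broom.
    by case: b => [j|[j|j]] /=; lia.
  have sym a b : double_broom a b = double_broom b a.
    by rewrite /double_broom orbC.
  have ne_arc a b : double_broom_square_arc a b -> a != b.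
    by apply: contraTneq => ->; case: b => [j|[j|j]] /=; lia.
  have ex_arc a b : double_broom_square_arc a b ->
      [exists w, double_broom a w && double_broom w b].
    case: a b => [i|[i|i]] [j|[j|j]] // h; move: (h) => /= h'.
    + by apply: (wY _ _ (Ordinal m0)); rewrite /double_broom /=.
    + by apply: (wY _ _ (Ordinal m0)); rewrite /double_broom /=; lia.
    + have lt : (i.+1 < m)%N by have := ltn_ord j; lia.
      by apply: (wY _ _ (Ordinal lt)); rewrite /double_broom /=; lia.
    + have lt : (i.+1 < m)%N by lia.
      by apply: (wY _ _ (Ordinal lt)); rewrite /double_broom /=; lia.
    + by apply: (wY _ _ (Ordinal mP)); rewrite /double_broom /=; lia.
  have arc a b : double_broom_square_arc a b ->
      (a != b) && [exists w, double_broom a w && double_broom w b].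
    by move=> h; rewrite ne_arc ?ex_arc.
  case/or3P => [h|/arc h|/arc h].
  + by rewrite h ne_edge.
  + by case/andP: h => -> ->; rewrite orbT.
  + case/andP: h => ne /existsP[w /andP[h1 h2]].
    rewrite eq_sym ne; apply/orP; right; apply/existsP; exists w.
    by rewrite (sym u) (sym w v) h1 h2.
- case/andP => ne /orP[->//|/existsP[w /andP[]]].
  case: u v w ne => [i|[i|i]] [j|[j|j]] [k|[k|k]] //=; rewrite /double_broom /=.
  all: try have := ltn_ord i; try have := ltn_ord j; try lia.
  all: move=> _ _ ne *; have : (i : nat) != j by
    apply: contra ne => /eqP /val_inj ->.
  all: lia.
Qed.

End DoubleBroom.

(* Main.v *)
From HB Require Import structures.
Require Import Defs.
From mathcomp Require Import all_boot all_order all_algebra.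
From mathcomp Require Import boolp.
From mathcomp Require Import mpoly.
From mathcomp Require Import zify ring.

(** The minimal closed neighborhoods in the square of the double broom are those
of the leaves at either end, and of the vertices in the middle of the handle,
five consecutive vertices of the handle each.

For a handle with four vertices only the first kind is minimal, and there are
two of them, without common vertices. So the ideal is generated by two
monomials [f] and [g] in disjoint sets of variables, a complete intersection,
and the quotient of the polynomial ring in [N] variables is Cohen--Macaulay of
dimension [N - 2] at every maximal ideal [P] ([two_monomials_cohen_macaulay]).
Upper bounds for height and depth come from one source: any [N - 1] elements of
the quotient satisfy a nontrivial polynomial relation over [K], by counting
monomials ([algebraic_relation]), and such a relation can neither hold among
elements chosen from the successive differences of a chain of primes nor among
the members of a regular sequence, since one may cancel powers of one variable
after the other until a nonzero constant is left ([filtration_relation]). For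
the lower bounds, the residue field of [P] is algebraic over [K] by the theorem
of Zariski ([generated_algebraic]); so [P] contains a nonzero polynomial in
each single coordinate. Two coordinates, one in [f] and one in [g], vanish at
[P]; freeing the others one by one gives a chain of primes ([point_chain]).
After the change of coordinates that subtracts these two from the other
variables of [f] and of [g], the polynomials [f] and [g] become monic, and with
the equations of the other coordinates they form a tower of monic equations in
separate variables, hence a regular sequence ([two_monomials_regular]). That
the quotient is Noetherian is the basis theorem of Hilbert.

For any other length of the handle there are components of different
dimensions through a common point. It is enough to find one where this prevents
the ring from being Cohen--Macaulay, and coordinates 0 and 1 suffice: near a
point with zero coordinates in [Z], only the part in [Z] of each neighborhood
matters. The set [Z] is chosen so that these parts generate an ideal of the
form [(t1, ..., tk, y * a, y * b)], which defines the union of a linear space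
with a linear space of smaller dimension. A regular sequence as long as the
height would satisfy a relation on the smaller component. This forces [y], and
then [a], into the ideal that the sequence generates locally, each as a
combination with some coefficient invertible at the point. But [y * a] is zero,
while two such combinations of a regular sequence have a nonzero product
([product_syzygy], [not_cohen_macaulay]). *)

Set Implicit Arguments.
Unset Strict Implicit.
Unset Printing Implicit Defensive.

Import GRing.Theory.

Local Open Scope ring_scope.

(** * Ideals given by generators *)

Section Ideals.
Variable R : comNzRingType.
Implicit Types (I : {pred R}) (s t : seq R) (u v x y : R).

Definition linear_pred I : Prop :=
  0 \in I /\ forall a, {in I &, forall u v, a * u + v \in I}.

Lemma idealr_linear I : idealr_closed I -> linear_pred I.
Proof. by case. Qed.

Lemma linear_idealr I : linear_pred I -> 1 \notin I -> idealr_closed I.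
Proof. by case=> I0 Il I1; split. Qed.

Section Linear.
Variable I : {pred R}.
Hypothesis Il : linear_pred I.

Lemma lin0 : 0 \in I. Proof. by case: Il. Qed.

Lemma linD u v : u \in I -> v \in I -> u + v \in I.
Proof. by case: Il => _ h uI vI; rewrite -[u]mul1r h. Qed.

Lemma linMl a u : u \in I -> a * u \in I.
Proof. by case: Il => I0 h uI; rewrite -[a * u]addr0 h. Qed.

Lemma linMr a u : u \in I -> u * a \in I.
Proof. by rewrite mulrC; apply: linMl. Qed.

Lemma linN u : u \in I -> - u \in I.
Proof. by move=> uI; rewrite -mulN1r linMl. Qed.

Lemma linB u v : u \in I -> v \in I -> u - v \in I.
Proof. by move=> uI vI; rewrite linD ?linN. Qed.

Lemma linBr u v : v \in I -> (u - v \in I) = (u \in I).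
Proof.
move=> vI; apply/idP/idP => [h|uI]; last exact: linB.
by rewrite -[u](subrK v) linD.
Qed.

Lemma linDr u v : v \in I -> (u + v \in I) = (u \in I).
Proof. by move=> vI; rewrite -[v]opprK linBr ?linN. Qed.

Lemma lin_sum (J : Type) (r : seq J) (P : pred J) (F : J -> R) :
  (forall j, P j -> F j \in I) -> \sum_(j <- r | P j) F j \in I.
Proof. by move=> h; elim/big_ind: _ => //; [exact: lin0|exact: linD]. Qed.

End Linear.

Lemma gen_lin s : linear_pred (gen_ideal s).
Proof.
split; last exact: gen_ideal_linear.
by apply/asboolP; exists (fun=> 0); rewrite big1 // => i _; rewrite mul0r.
Qed.

Lemma genP s u :
  reflect (exists c : nat -> R, u = \sum_(i < size s) c i * s`_i)
          (u \in gen_ideal s).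
Proof.
apply: (iffP (asboolP _)) => [[c ->]|[c ->]]; last by exists (fun i => c i).
exists (fun n => if insub n is Some i then c i else 0).
by apply: eq_bigr => i _; rewrite valK.
Qed.

Lemma gen_nil u : (u \in gen_ideal [::]) = (u == 0).
Proof.
apply/genP/eqP => [[c ->]|->]; first by rewrite big_ord0.
by exists (fun=> 0); rewrite big_ord0.
Qed.

Lemma gen_consP x s u :
  reflect (exists a, u - a * x \in gen_ideal s) (u \in gen_ideal (x :: s)).
Proof.
apply: (iffP (genP _ _)) => [[c ->]|[a /genP[c h]]].
  exists (c 0%N); rewrite big_ord_recl /= addrC addKr; apply/genP.
  by exists (fun i => c i.+1).
exists (fun n => if n is n'.+1 then c n' else a).
by rewrite big_ord_recl /= -h addrC subrK.
Qed.

Lemma gen_mem s u : u \in s -> u \in gen_ideal s.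
Proof.
elim: s => // x s IH; rewrite inE => /predU1P[->|/IH h]; apply/gen_consP.
  by exists 1; rewrite mul1r subrr (lin0 (gen_lin s)).
by exists 0; rewrite mul0r subr0.
Qed.

Lemma gen_sub s I :
  linear_pred I -> {subset s <= I} -> {subset gen_ideal s <= I}.
Proof.
move=> Il; elim: s => [_ u|x s IH sI u].
  by rewrite gen_nil => /eqP ->; case: Il.
case/gen_consP => a h; rewrite -[u](subrK (a * x)); apply: linD => //.
  by apply: IH h => v vs; apply: sI; rewrite inE vs orbT.
by apply: linMl => //; apply: sI; rewrite inE eqxx.
Qed.

Lemma gen_sub_gen s t :
  {subset s <= gen_ideal t} -> {subset gen_ideal s <= gen_ideal t}.
Proof. exact: gen_sub (gen_lin t). Qed.

Lemma gen_mono s t : {subset s <= t} -> {subset gen_ideal s <= gen_ideal t}.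
Proof. by move=> st; apply: gen_sub_gen => u /st; apply: gen_mem. Qed.

Lemma gen_catP s t u :
  reflect (exists2 v, v \in gen_ideal s & u - v \in gen_ideal t)
          (u \in gen_ideal (s ++ t)).
Proof.
apply: (iffP idP); last first.
  case=> v vs h; rewrite -[u](subrK v); apply: linD; first exact: gen_lin.
    by apply: gen_mono h => w wt; rewrite mem_cat wt orbT.
  by apply: gen_mono vs => w wt; rewrite mem_cat wt.
elim: s u => [u h|x s IH u].
  by exists 0; rewrite ?subr0 // (lin0 (gen_lin _)).
rewrite cat_cons => /gen_consP[a /IH[v vs h]]; exists (v + a * x).
  by apply/gen_consP; exists a; rewrite addrK.
by rewrite opprD addrA addrAC.
Qed.

(** Regularity without the condition that the sequence generates a proper
ideal, so that it can be carried along arbitrary ring maps. *)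
Definition weakly_regular s : Prop :=
  forall i r, (i < size s)%N ->
    s`_i * r \in gen_ideal (take i s) -> r \in gen_ideal (take i s).

Lemma weakly_regular_take s k :
  weakly_regular s -> weakly_regular (take k s).
Proof.
move=> reg i r; rewrite size_take_min leq_min => /andP[ik isz].
by rewrite nth_take // take_takel ?(ltnW ik) //; apply: reg.
Qed.

End Ideals.

Section Morphisms.
Variables (R S : comNzRingType) (phi : {rmorphism R -> S}).

Lemma gen_map (s : seq R) u :
  u \in gen_ideal s -> phi u \in gen_ideal (map phi s).
Proof.
elim: s u => [u|x s IH u].
  by rewrite gen_nil => /eqP ->; rewrite rmorph0 gen_nil.
case/gen_consP => a /IH; rewrite rmorphB rmorphM => h.
by apply/gen_consP; exists (phi a).
Qed.

Lemma gen_map_surj (s : seq R) u :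
  (forall y, exists x, phi x = y) -> u \in gen_ideal (map phi s) ->
  exists2 v, v \in gen_ideal s & phi v = u.
Proof.
move=> surj; elim: s u => [u|x s IH u].
  rewrite gen_nil => /eqP ->; exists 0; rewrite ?rmorph0 //.
  by rewrite gen_nil.
case/gen_consP => b /IH[v vs e]; have [a ea] := surj b.
exists (v + a * x); first by apply/gen_consP; exists a; rewrite addrK.
by rewrite rmorphD rmorphM e ea subrK.
Qed.

Lemma preim_linear (I : {pred S}) :
  linear_pred I -> linear_pred [pred x | phi x \in I].
Proof.
move=> Il; split=> [|a u v]; rewrite !inE ?rmorph0 ?(lin0 Il) // => uI vI.
by rewrite rmorphD rmorphM linD ?linMl.
Qed.

End Morphisms.
(** * Algebraic relations bound chains of primes and regular sequences *)

Section Relations.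
Variables (K : fieldType) (S : comNzRingType) (kap : {rmorphism K -> S}).
Implicit Types (c : seq nat -> K) (e : seq nat) (r : seq S) (t : nat).

(** The value at [r] of the polynomial of degree less than [t] in each of
[size r] variables with coefficients [c]; nesting the sums lets the proofs
treat the first variable alone. *)
Fixpoint poly_value t c r : S :=
  if r is x :: r' then
    \sum_(i < t) x ^+ i * poly_value t (fun e => c (val i :: e)) r'
  else kap (c [::]).

Definition exponents t r : {pred seq nat} :=
  [pred e | (size e == size r) && all (fun i => i < t)%N e].

Lemma poly_value0 t c r :
  (forall e, e \in exponents t r -> c e = 0) -> poly_value t c r = 0.
Proof.
elim: r c => [|x r IH] c h /=; first by rewrite h ?rmorph0.
rewrite big1 // => i _; rewrite IH ?mulr0 // => e he; apply: h.
by move: he; rewrite !inE /= eqSS ltn_ord.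
Qed.

(** The filtration may be a chain of primes with [r`_i] in the difference of
two consecutive ones, or come from the ideals generated by the initial parts of
a regular sequence. In the polynomial with value in [I 0] the lowest power of
the first variable cancels, and the coefficient of that power has its value in
[I 1], because the first variable takes a value in [I 1]. Repeating this leaves
a nonzero constant. *)
Lemma filtration_relation (I : nat -> {pred S}) r t c :
    (forall i, linear_pred (I i)) ->
    (forall i, (i < size r)%N ->
       [/\ {subset I i <= I i.+1}, r`_i \in I i.+1
         & forall u, r`_i * u \in I i -> u \in I i]) ->
    (exists2 e, e \in exponents t r & c e != 0) ->
  poly_value t c r \in I 0%N -> 1 \in I (size r).
Proof.
elim: r I c => [|x r IH] I c Il reg [e0 he0 ce0] /=.
  case: e0 he0 ce0 => // _ ce0 h; rewrite -(rmorph1 kap) -(mulVf ce0) rmorphM.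
  by apply: linMl.
pose nz i := `[< exists2 e, e \in exponents t r & c (i :: e) != 0 >].
have exm : exists i, (i < t)%N && nz i.
  case: e0 he0 ce0 => // i e; rewrite inE /= eqSS => /and3P[sz it al] ce.
  by exists i; rewrite it; apply/asboolP; exists e; rewrite // inE sz.
case: (ex_minnP exm) => m /andP[mt /asboolP cm] m_min.
have [I01 xI xreg] := reg 0%N isT.
move=> h; apply: (IH (fun i => I i.+1) _ _ _ cm); first by move=> i; apply: Il.
  by move=> i ir; apply: (reg i.+1).
set P := fun i => poly_value t (fun e => c (i :: e)) r in h *.
have Pz i : (i < m)%N -> P i = 0.
  move=> im; apply: poly_value0 => e he; apply/eqP/negP => /negP ce.
  have : (i < t)%N && nz i.
    by rewrite (ltn_trans im mt); apply/asboolP; exists e.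
  by move/m_min; rewrite leqNgt im.
have e1 : \sum_(i < t) x ^+ i * P i =
    x ^+ m * (P m + x * \sum_(m.+1 <= i < t) x ^+ (i - m.+1) * P i).
  rewrite -(big_mkord xpredT (fun i => x ^+ i * P i)).
  rewrite (@big_cat_nat _ _ _ m) ?(ltnW mt) //=.
  rewrite big1_seq ?add0r; last first.
    by move=> i; rewrite mem_index_iota => /Pz ->; rewrite mulr0.
  rewrite big_ltn // mulrDr; congr (_ + _).
  rewrite !mulr_sumr; apply: eq_big_nat => i /andP[mi _].
  by rewrite !mulrA -exprSr -exprD subnKC.
have {}h : P m + x * \sum_(m.+1 <= i < t) x ^+ (i - m.+1) * P i \in I 0%N.
  move: h; rewrite e1; move: (_ + _) => w; clear -xreg.
  by elim: m => [|k IHk]; rewrite ?mul1r // exprS -mulrA => /xreg /IHk.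
by move/I01: h; rewrite linDr ?linMr.
Qed.

Fixpoint monomial_value r e : S :=
  if r is x :: r' then x ^+ head 0%N e * monomial_value r' (behead e) else 1.

Lemma poly_value_sum t (J : finType) (c : J -> seq nat -> K) r :
  poly_value t (fun e => \sum_j c j e) r = \sum_j poly_value t (c j) r.
Proof.
elim: r c => [|x r IH] c /=; first by rewrite rmorph_sum.
rewrite exchange_big /=; apply: eq_bigr => i _.
by rewrite -mulr_sumr -IH.
Qed.

Lemma poly_value_delta t a e0 r : e0 \in exponents t r ->
  poly_value t (fun e => if e0 == e then a else 0) r =
  kap a * monomial_value r e0.
Proof.
elim: r e0 => [|x r IH] [|i e0] //=; first by rewrite mulr1.
rewrite inE /= eqSS => /and3P[sz it al].
rewrite (bigD1 (Ordinal it)) //= [X in _ + X]big1 ?addr0 => [|j ne].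
  under [X in poly_value _ X _]eq_fun do rewrite eqseq_cons eqxx.
  by rewrite IH ?inE ?sz // mulrCA.
rewrite poly_value0 ?mulr0 // => e _; rewrite eqseq_cons.
by case: eqP => // ij; case/eqP: ne; apply: val_inj.
Qed.

End Relations.

Section AlgebraicDependence.
Variables (K : fieldType) (N : nat).
Local Notation S := {mpoly K[N]}.
Implicit Types (m : 'X_{1..N}) (r : seq S).

Definition mnm_support m : {set 'I_N} := [set i | m i != 0%N].

Lemma msizeM_pred (p q : S) : (msize (p * q) <= (msize p + msize q).-1)%N.
Proof.
have [->|p0] := eqVneq p 0; first by rewrite mul0r msize0.
have [->|q0] := eqVneq q 0; first by rewrite mulr0 msize0.
by rewrite msizeM.
Qed.

Lemma monomial_value_size B t r e :
    (forall p, p \in r -> (msize p <= B.+1)%N) -> e \in exponents t r ->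
  (msize (monomial_value r e) <= size r * t * B + 1)%N.
Proof.
elim: r e => [|x r IH] [|i e] //= rB; first by rewrite msize1 addn1.
rewrite inE /= eqSS => /and3P[sz it al].
have h1 : (msize (x ^+ i) <= i * B + 1)%N.
  elim: (i) => [|k IHk]; first by rewrite expr0 msize1.
  rewrite exprS; apply: leq_trans (msizeM_pred _ _) _.
  by have := rB x (mem_head _ _); lia.
have h2 : (msize (monomial_value r e) <= size r * t * B + 1)%N.
  by apply: IH; rewrite ?inE ?sz // => p pr; apply: rB; rewrite inE pr orbT.
apply: leq_trans (msizeM_pred _ _) _.
have : (i * B <= t * B)%N by rewrite leq_mul2r ltnW ?orbT.
move: h1 h2; rewrite mulSn mulnDl /=.
move: (msize _) (msize _) (i * B)%N (t * B)%N (size r * t * B)%N => a b u v w; lia.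
Qed.

(** There are [t ^ d.+1] products of powers of [r] with exponents less than
[t]. Their degrees are bounded linearly in [t], so the number of monomials with
support in some [D j] that occur in them grows like [t ^ d] only. For large [t]
a linear combination of the products avoids all those monomials. *)
Lemma algebraic_relation (d : nat) (J : finType) (D : J -> {set 'I_N}) r :
    (forall j, #|D j| <= d)%N -> size r = d.+1 ->
  exists t c, (exists2 e, e \in exponents t r & c e != 0) /\
    forall m j, mnm_support m \subset D j ->
      (poly_value (@mpolyC N K) t c r)@_m = 0.
Proof.
move=> Dd szr; pose B := \max_(p <- r) msize p.
have rB p : p \in r -> (msize p <= B.+1)%N.
  by move=> pr; apply/leqW; rewrite /B (big_rem p) //= leq_maxl.
(* the degrees of the products are less than [T <= t * E], and [t] is large
   enough for [t ^ d.+1] to exceed [#|J| * (t * E) ^ d] *)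
pose E := (d.+1 * B + 2)%N; pose t := (#|J| * E ^ d).+1.
pose T := (d.+1 * t * B + 2)%N.
have TE : (T <= t * E)%N by rewrite /T /E; nia.
pose supp (h : {ffun 'I_N -> 'I_T}) j := [forall i, (h i != 0%N :> nat) ==> (i \in D j)].
pose C := [set h : {ffun 'I_N -> 'I_T} | [exists j, supp h j]].
have T0 : (0 < T)%N by rewrite /T addn2.
have cardC : (#|C| <= #|J| * T ^ d)%N.
  have -> : C = \bigcup_j [set h | supp h j].
    apply/setP => h; rewrite inE; apply/existsP/bigcupP => [[j hj]|[j _]].
      by exists j; rewrite // inE.
    by rewrite inE; exists j.
  rewrite -sum_nat_const.
  elim/big_rec2: _ => [|j a b _ le]; first by rewrite cards0.
  apply: leq_trans (leq_card_setU _ _) _; rewrite leq_add //.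
  rewrite (@eq_card _ _ (pffun_on (Ordinal T0) (D j) predT)); last first.
    move=> h; rewrite inE; apply/forallP/pffun_onP.
      move=> hs; split; last by [].
      by apply/subsetP => i /= ne; apply: (implyP (hs i)).
    case=> /subsetP hs _ i; apply/implyP => ne; apply: hs.
    by rewrite inE; apply: contra ne => /eqP ->.
  rewrite card_pffun_on cardT size_enum_ord.
  by rewrite leq_pexp2l.
have lt_card : (#|C| < t ^ d.+1)%N.
  apply: leq_ltn_trans cardC _; apply: leq_ltn_trans (_ : #|J| * (t * E) ^ d < _)%N.
    rewrite leq_mul2l; apply/orP; right; by elim: (d) => // k IH; rewrite !expnS leq_mul.
  rewrite expnMn mulnCA expnS mulnC ltn_pmul2r ?expn_gt0 //.
pose tup (i : 'I_#|{: (d.+1).-tuple 'I_t}|) : seq nat := map val (enum_val i).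
pose mn (h : {ffun 'I_N -> 'I_T}) : 'X_{1..N} := [multinom val (h i) | i < N].
pose M : 'M[K]_(_, #|C|) :=
  \matrix_(i, j) (monomial_value r (tup i))@_(mn (enum_val j)).
have : kermx M != 0.
  rewrite kermx_eq0 /row_free neq_ltn (leq_ltn_trans (rank_leq_col M)) //.
  by rewrite card_tuple card_ord.
case/rowV0Pn => lam /sub_kermxP lamM lam0.
have [i0 lami0] : exists i0, lam 0 i0 != 0.
  apply/existsP; apply: contraR lam0 => /existsPn h; apply/eqP/rowP => i.
  by rewrite mxE; apply/eqP/negPn.
have tupE i : tup i \in exponents t r.
  rewrite inE size_map size_tuple szr eqxx all_map /=.
  by apply/allP => x _ /=.
have tupI : injective tup.
  by move=> i j /(inj_map val_inj)/val_inj/enum_val_inj.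
pose c e := \sum_i (if tup i == e then lam 0 i else 0).
exists t, c; split.
  exists (tup i0) => //; rewrite /c (bigD1 i0) //= eqxx big1 ?addr0 // => i ne.
  by case: eqP => // /tupI ii; rewrite ii eqxx in ne.
move=> m j mD.
have -> : poly_value (@mpolyC N K) t c r =
    \sum_i lam 0 i *: monomial_value r (tup i).
  rewrite (poly_value_sum (@mpolyC N K)); apply: eq_bigr => i _.
  by rewrite poly_value_delta // mul_mpolyC.
rewrite raddf_sum /=.
have [mT|Tm] := ltnP (mdeg m) T; last first.
  rewrite big1 // => i _; rewrite mcoeffZ (_ : _@_m = 0) ?mulr0 //.
  apply/eqP; rewrite mcoeff_eq0; apply: msize_mdeg_ge.
  apply: leq_trans Tm; apply: leq_trans (monomial_value_size rB (tupE i)) _.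
  by rewrite szr /T leq_add2l.
have miT i : (m i < T)%N.
  by apply: leq_ltn_trans mT; rewrite mdegE (bigD1 i) //= leq_addr.
pose h := [ffun i => Ordinal (miT i)].
have hC : h \in C.
  rewrite inE; apply/existsP; exists j; apply/forallP => i; rewrite ffunE /=.
  by apply/implyP => mi; apply: (subsetP mD); rewrite inE.
have <- : mn h = m by apply/mnmP => i; rewrite mnmE ffunE.
have := congr1 (fun A : 'rV_#|C| => A 0 (enum_rank_in hC h)) lamM.
rewrite !mxE => e; rewrite -[RHS]e; apply: eq_bigr => i _.
by rewrite mcoeffZ !mxE enum_rankK_in.
Qed.

End AlgebraicDependence.
Section RelationConsequences.
Variables (K : fieldType) (R : comNzRingType) (kap : {rmorphism K -> R}).
Implicit Types (r : seq R) (c : seq nat -> K).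

Lemma poly_value_map (R' : comNzRingType) (phi : {rmorphism R -> R'}) t c r :
  phi (poly_value kap t c r) = poly_value (phi \o kap) t c (map phi r).
Proof.
elim: r c => [|x r IH] c //=; rewrite rmorph_sum; apply: eq_bigr => i _.
by rewrite rmorphM rmorphXn IH.
Qed.

Lemma prime_chain_relation (P : {pred R}) k :
    prime_chain P k ->
    (forall r, size r = k -> exists t c,
       (exists2 e, e \in exponents t r & c e != 0) /\ poly_value kap t c r = 0) ->
  False.
Proof.
case=> Q [Qprime Qlt _] rel.
have [i|x xP] := boolp.choice (P := fun i y =>
    (i < k)%N -> y \in Q i.+1 /\ y \notin Q i).
  have [ik|ki] := ltnP i k; last by exists 0.
  by have [_ /existsPNP[y yQ /negP yQ']] := Qlt i ik; exists y.
have szx : size (mkseq x k) = k by rewrite size_mkseq.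
have [t [c [nz c0]]] := rel (mkseq x k) szx.
have Qlin i : linear_pred (Q (minn i k)).
  by apply/idealr_linear; case: (Qprime (minn i k) (geq_minr _ _)).
have := filtration_relation (kap := kap) (I := fun i => Q (minn i k)) Qlin _ nz.
rewrite szx c0 (lin0 (Qlin 0%N)) minnn => h.
suff : 1 \in Q k by case: (Qprime k (leqnn k)) => -[_ /negP].
apply: h => // i ik; rewrite nth_mkseq // !minnE.
have -> : (i - (i - k) = i)%N by lia.
have -> : (i.+1 - (i.+1 - k) = i.+1)%N by lia.
have [Qi Qi'] := xP i ik; have [QQ _] := Qlt i ik.
split=> // u xu; have [_ pr] := Qprime i (ltnW ik).
by have := pr _ _ xu; rewrite (negbTE Qi').
Qed.

(** The factor [u] makes room for relations that hold on a single component of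
the spectrum: [u] is then a function that vanishes on the other ones. *)
Lemma regular_relation r t c u :
    weakly_regular r -> (exists2 e, e \in exponents t r & c e != 0) ->
    poly_value kap t c r * u = 0 ->
  u \in gen_ideal r.
Proof.
move=> reg nz c0; pose I i : {pred R} := [pred x | x * u \in gen_ideal (take i r)].
have Ilin i : linear_pred (I i).
  have gl := gen_lin (take i r).
  split=> [|a x y]; rewrite !inE ?mul0r ?(lin0 gl) // => xI yI.
  by rewrite mulrDl -mulrA (linD gl) // (linMl gl).
have := filtration_relation (kap := kap) (I := I) Ilin _ nz.
rewrite !inE c0 (lin0 (gen_lin _)) mul1r take_size; apply=> // i ir; split.
- move=> x; rewrite !inE (take_nth 0 ir); apply: gen_mono => y.
  by rewrite mem_rcons inE orbC => ->.
- rewrite inE linMr //; first exact: gen_lin.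
  by apply: gen_mem; rewrite (take_nth 0 ir) mem_rcons mem_head.
- by move=> x; rewrite !inE -mulrA; apply: reg.
Qed.

End RelationConsequences.

(** * Monomial ideals *)

Section MonomialIdeals.
Variables (K : fieldType) (N : nat).
Local Notation S := {mpoly K[N]}.
Implicit Types (m : 'X_{1..N}) (E F G : {set 'I_N}) (p u : S).

Definition mon E : S := \prod_(i in E) 'X_i.

Lemma mon_dvd E m : E \subset mnm_support m -> exists p, 'X_[m] = p * mon E.
Proof.
move=> Em; exists 'X_[m - \sum_(i in E) U_(i)]; rewrite /mon.
rewrite mprodXE -mpolyXD; congr 'X_[_]; rewrite submK //.
apply/mnm_lepP => i; rewrite mnm_sumE.
have [iE|iE] := boolP (i \in E); last first.
  by rewrite big1 // => j jE; rewrite mnm1E; case: eqP iE => // <-; rewrite jE.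
rewrite (bigD1 i) //= mnm1E eqxx big1 ?addn0 => [|j /andP[_ ne]].
  by have := subsetP Em i iE; rewrite inE lt0n.
by rewrite mnm1E (negbTE ne).
Qed.

Lemma linear_msupp (I : {pred S}) u p :
    linear_pred I -> (forall m, m \in msupp p -> 'X_[m] * u \in I) ->
  p * u \in I.
Proof.
move=> Il h; rewrite [p]mpolyE big_seq mulr_suml; apply: lin_sum => // m mp.
by rewrite -mul_mpolyC -mulrA; apply: linMl => //; apply: h.
Qed.

End MonomialIdeals.

(** * Products of two monomials without common variables *)

Section TwoMonomials.
Variables (K : fieldType) (N : nat) (F G : {set 'I_N}).
Hypotheses (FG : [disjoint F & G]) (F0 : F != set0) (G0 : G != set0).
Local Notation S := {mpoly K[N]}.
Local Notation I := (gen_ideal [:: mon K F; mon K G]).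

(** A monomial outside the ideal misses a variable of [F] and one of [G], so
that only [N - 2] variables occur in it. *)
Lemma two_monomials_relation (r : seq S) : (size r).+1 = N ->
  exists t c, (exists2 e, e \in exponents t r & c e != 0) /\
    poly_value (@mpolyC N K) t c r \in I.
Proof.
move=> szr.
pose J := {x : 'I_N * 'I_N | (x.1 \in F) && (x.2 \in G)}.
pose D (j : J) : {set 'I_N} := ~: [set (val j).1; (val j).2].
have ne (j : J) : (val j).1 != (val j).2.
  case: j => -[v w] /= /andP[vF wG]; apply: contraTneq wG => <-.
  by rewrite (disjointFr FG).
have Dd j : (#|D j| <= (N.-1).-1)%N.
  by rewrite cardsCs setCK cards2 ne card_ord; lia.
have N2 : (1 < N)%N.
  case/set0Pn: F0 => v vF; case/set0Pn: G0 => w wG.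
  have vw : ((v, w).1 \in F) && ((v, w).2 \in G) by rewrite vF.
  have := ne (Sub (v, w) vw); rewrite /= -val_eqE /=.
  by have := ltn_ord v; have := ltn_ord w; lia.
have [|t [c [nz h]]] := algebraic_relation Dd (r := r); first by lia.
exists t, c; split=> //; rewrite -[poly_value _ _ _ _]mulr1.
apply: linear_msupp; [exact: gen_lin|move=> m]; rewrite mulr1 mcoeff_msupp => cm.
have mon_in E : (E == F) || (E == G) -> E \subset mnm_support m ->
    'X_[m] \in I.
  move=> EFG /(mon_dvd K)[p ->]; apply: linMl; first exact: gen_lin.
  by apply: gen_mem; rewrite !inE; case/orP: EFG => /eqP ->; rewrite eqxx ?orbT.
have [|/subsetPn[v vF mv]] := boolP (F \subset mnm_support m).
  by apply: mon_in; rewrite eqxx.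
have [|/subsetPn[w wG mw]] := boolP (G \subset mnm_support m).
  by apply: mon_in; rewrite eqxx orbT.
have vw : ((v, w).1 \in F) && ((v, w).2 \in G) by rewrite vF.
case/eqP: cm; apply: (h m (Sub (v, w) vw)).
apply/subsetP => i im; rewrite !inE negb_or /=.
by apply/andP; split; [apply: contraNneq mv|apply: contraNneq mw] => <-.
Qed.

End TwoMonomials.
(** * Prime chains through a point *)

Section Factor.
Variables (S R A : comNzRingType) (pi : {rmorphism S -> R}) (phi : {rmorphism S -> A}).
Hypotheses (pi_surj : forall x, exists t, pi t = x)
  (phi_ker : forall t, pi t = 0 -> phi t = 0).

Lemma factor_rmorphism :
  exists psi : {rmorphism R -> A}, forall t, psi (pi t) = phi t.
Proof.
have [sec secK] := boolp.choice pi_surj.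
have phi_eq t t' : pi t = pi t' -> phi t = phi t'.
  move=> e; apply/eqP; rewrite -subr_eq0 -rmorphB; apply/eqP/phi_ker.
  by rewrite rmorphB e subrr.
pose psi x := phi (sec x).
have psi_add : zmod_morphism psi.
  by move=> x y; rewrite /psi -rmorphB; apply: phi_eq; rewrite rmorphB !secK.
have psi_mul : monoid_morphism psi.
  split=> [|x y]; first by rewrite /psi -(rmorph1 phi); apply: phi_eq; rewrite secK rmorph1.
  by rewrite /psi -rmorphM; apply: phi_eq; rewrite rmorphM !secK.
pose M1 := GRing.isZmodMorphism.Build R A psi psi_add.
pose M2 := GRing.isMonoidMorphism.Build R A psi psi_mul.
pose psi' : {rmorphism R -> A} := HB.pack psi M1 M2.
by exists psi' => t; apply: phi_eq; rewrite secK.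
Qed.

End Factor.

Lemma kernel_prime (R : comNzRingType) (A : idomainType) (psi : {rmorphism R -> A}) :
  prime_ideal [pred x | psi x == 0].
Proof.
split; last by move=> x y; rewrite !inE rmorphM mulf_eq0.
split=> [||a x y]; rewrite !inE ?rmorph0 ?rmorph1 ?oner_eq0 //.
by move=> /eqP x0 /eqP y0; rewrite rmorphD rmorphM x0 y0 mulr0 addr0.
Qed.

Lemma mpoly_rmorph_ext (N : nat) (K : comNzRingType) (A : nzRingType)
    (f g : {rmorphism {mpoly K[N]} -> A}) :
  (forall c, f c%:MP = g c%:MP) -> (forall i, f 'X_i = g 'X_i) -> f =1 g.
Proof.
move=> fgC fgX p; rewrite [p]mpolyE !rmorph_sum; apply: eq_bigr => m _.
rewrite -mul_mpolyC !rmorphM fgC mpolyXE_id !rmorph_prod; congr (_ * _).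
by apply: eq_bigr => i _; rewrite !rmorphXn fgX.
Qed.

Section PointChain.
Variables (K L : fieldType) (N : nat) (kap : {rmorphism K -> L}) (a : 'I_N -> L).
Local Notation S := {mpoly K[N]}.
Implicit Types (D : {set 'I_N}).

(** The coordinates in [D] are fixed at those of the point [a], the others
stay free; the kernels will be the members of a chain of primes. *)
Definition specialization D : {rmorphism S -> {mpoly L[N]}} :=
  mmap (@mpolyC N L \o kap) (fun i => if i \in D then (a i)%:MP else 'X_i).

Definition point_eval : {rmorphism S -> L} := mmap kap a.

Lemma specializationC D c : specialization D c%:MP = (kap c)%:MP.
Proof. by rewrite /specialization /= mmapC. Qed.

Lemma specializationX D i :
  specialization D 'X_i = if i \in D then (a i)%:MP else 'X_i.
Proof. by rewrite /specialization /= mmapX mmap1U. Qed.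

Lemma specialization_sub D D' t : D \subset D' ->
  specialization D t = 0 -> specialization D' t = 0.
Proof.
move=> DD' t0.
pose g : {rmorphism {mpoly L[N]} -> {mpoly L[N]}} :=
  mmap (@mpolyC N L) (fun i => if i \in D' then (a i)%:MP else 'X_i).
have -> : specialization D' t = (g \o specialization D) t; last first.
  by rewrite /= t0 rmorph0.
apply: mpoly_rmorph_ext => [c|i]; rewrite [RHS]/= ?specializationC ?specializationX.
  by rewrite /g /= mmapC.
case: (boolP (i \in D)) => [iD|iD]; rewrite /g /= ?mmapC ?mmapX ?mmap1U //.
by rewrite (subsetP DD').
Qed.

Lemma specialization_setT t : specialization setT t = (point_eval t)%:MP.
Proof.
have -> : (point_eval t)%:MP = (@mpolyC N L \o point_eval) t by [].
apply: mpoly_rmorph_ext => [c|i]; rewrite [RHS]/=.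
  by rewrite specializationC /point_eval /= mmapC.
by rewrite specializationX inE /point_eval /= mmapX mmap1U.
Qed.

Lemma specialization_poly D i (p : {poly K}) :
  specialization D (map_poly (@mpolyC N K) p).['X_i] =
  if i \in D then ((map_poly kap p).[a i])%:MP
  else (map_poly (@mpolyC N L \o kap) p).['X_i].
Proof.
rewrite -horner_map -map_poly_comp specializationX.
rewrite (eq_map_poly (g := @mpolyC N L \o kap)); last first.
  by move=> c; apply: specializationC.
by case: ifP => // _; rewrite map_poly_comp horner_map.
Qed.

Lemma specialization_poly_neq0 i (p : {poly K}) : p != 0 ->
  (map_poly (@mpolyC N L \o kap) p).['X_i] != 0.
Proof.
pose g : {rmorphism {mpoly L[N]} -> {poly L}} := mmap polyC (fun=> 'X).
move=> p0; apply: contra_neq p0 => /(congr1 g).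
rewrite rmorph0 -horner_map /= -map_poly_comp /g /= mmapX mmap1U.
rewrite (eq_map_poly (g := polyC \o kap)); last by move=> c; rewrite /= mmapC.
rewrite map_poly_comp -/(comp_poly 'X (map_poly kap p)) comp_polyXr => /eqP.
by rewrite map_poly_eq0 => /eqP.
Qed.

(** Freeing the coordinates of an algebraic point one after the other gives
primes; the equation of a coordinate over [K] separates the prime in which
the coordinate is fixed from the one in which it is free. *)
Lemma point_chain (R : comNzRingType) (pi : {rmorphism S -> R}) (P : {pred R}) D0 :
    (forall x, exists t, pi t = x) ->
    (forall t, pi t = 0 -> specialization D0 t = 0) ->
    (forall i, exists2 p : {poly K}, p != 0 & (map_poly kap p).[a i] = 0) ->
    (forall t, (pi t \in P) = (point_eval t == 0)) ->
  prime_chain P (N - #|D0|).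
Proof.
move=> pi_surj D0ker alg PE.
pose l := enum (~: D0); pose k := (N - #|D0|)%N.
have szl : size l = k by rewrite -cardE cardsCs setCK card_ord.
pose D i := D0 :|: [set x in take i l].
have D0D i : D0 \subset D i by apply: subsetUl.
have [psi psiE] := boolp.choice (fun i => factor_rmorphism (phi := specialization (D i)) pi_surj
  (fun t h => specialization_sub (D0D i) (D0ker t h))).
exists (fun i => [pred x | psi i x == 0] : {pred R}); split=> [i _|i ik|x].
- exact: kernel_prime.
- have DD : D i \subset D i.+1.
    apply/subsetP => x; rewrite !inE => /orP[->//|].
    by rewrite -(take_takel _ (leqnSn i)) => /mem_take ->; rewrite orbT.
  split=> [x|].
    have [t <-] := pi_surj x; rewrite !inE !psiE => /eqP h.
    by apply/eqP; apply: specialization_sub DD h.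
  have il : (i < size l)%N by rewrite szl.
  have [x0 lE] : exists x0, take i.+1 l = rcons (take i l) x0.
    move: (l) il => [|y l'] // il; exists (nth y (y :: l') i).
    exact: take_nth.
  have xD : x0 \in D i.+1 by rewrite !inE lE mem_rcons mem_head orbT.
  have xD' : x0 \notin D i.
    have ul : uniq (take i.+1 l) by rewrite take_uniq ?enum_uniq.
    rewrite !inE negb_or; move: ul; rewrite lE rcons_uniq => /andP[-> _].
    have : x0 \in l by apply: (@mem_take i.+1); rewrite lE mem_rcons mem_head.
    by rewrite mem_enum inE => ->.
  have [p p0 px] := alg x0.
  move/(_ (pi (map_poly (@mpolyC N K) p).['X_x0])); rewrite !inE !psiE.
  rewrite !specialization_poly xD (negbTE xD') px mpolyC0 eqxx => /(_ isT).
  by rewrite (negbTE (specialization_poly_neq0 _ p0)).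
- have [t <-] := pi_surj x; rewrite PE inE psiE.
  have -> : D k = setT.
    apply/setP => y; rewrite !inE -szl take_size mem_enum inE.
    by case: (y \in D0).
  by rewrite specialization_setT mpolyC_eq0.
Qed.

(** The kernel of evaluation is maximal because its image is a field. *)
Lemma point_maximal (R : comNzRingType) (pi : {rmorphism S -> R}) (P : {pred R}) :
    (forall x, exists t, pi t = x) ->
    (forall t, (pi t \in P) = (point_eval t == 0)) ->
    (forall y, exists t, point_eval t = y) ->
  maximal_ideal P.
Proof.
move=> pi_surj PE ev_surj; split.
  split; first by rewrite -(rmorph0 pi) PE rmorph0.
    by rewrite -(rmorph1 pi) PE rmorph1 oner_eq0.
  move=> x u v; have [t <-] := pi_surj x.
  have [t1 <-] := pi_surj u; have [t2 <-] := pi_surj v.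
  rewrite -rmorphM -rmorphD !PE => /eqP h1 /eqP h2.
  by rewrite rmorphD rmorphM h1 h2 mulr0 addr0.
move=> I [I0 I1 Il] PI x; have [t <-] := pi_surj x; rewrite PE => tI.
apply/negPn/negP => t0; case/negP: I1.
have [t' t'E] := ev_surj (point_eval t)^-1.
have : pi (1 - t' * t) \in I.
  by apply: PI; rewrite PE rmorphB rmorphM rmorph1 t'E mulVf ?subrr.
rewrite rmorphB rmorph1 rmorphM => h.
by rewrite -[1](subrK (pi t' * pi t)) addrC; apply: Il.
Qed.

End PointChain.
(** * Quadratic relations among the members of a regular sequence *)

Section QuasiRegular.
Variables (R : comNzRingType) (r : nat -> R) (n : nat).
Local Notation J h := (gen_ideal (mkseq r h)).
Hypothesis reg : forall i x, (i < n)%N -> r i * x \in J i -> x \in J i.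

Lemma mkseq_genP h x :
  reflect (exists c : nat -> R, x = \sum_(i < h) c i * r i) (x \in J h).
Proof.
apply: (iffP (genP _ _)) => -[c ->]; exists c; rewrite size_mkseq;
  by apply: eq_bigr => i _; rewrite nth_mkseq.
Qed.

Lemma mkseq_gen_le h h' x : (h <= h')%N -> x \in J h -> x \in J h'.
Proof.
move=> hh'; apply: gen_mono => y /mapP[i]; rewrite mem_iota => /andP[_ ih] ->.
by apply: map_f; rewrite mem_iota (leq_trans ih hh').
Qed.

Lemma mkseq_gen_mem h i : (i < h)%N -> r i \in J h.
Proof. by move=> ih; apply/gen_mem/map_f; rewrite mem_iota. Qed.

(** The last coefficient lies in the ideal of the earlier members by
regularity; subtracting trivial syzygies between them and the last member
leaves a shorter relation. *)
Lemma linear_syzygy h (c : nat -> R) : (h <= n)%N ->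
  \sum_(i < h) c i * r i = 0 -> forall i, (i < h)%N -> c i \in J h.
Proof.
elim: h c => // h IH c hn; rewrite big_ord_recr /= => e.
have ch : c h \in J h.
  apply: reg => //; apply/mkseq_genP; exists (fun i => - c i).
  move/eqP: e; rewrite addrC addr_eq0 mulrC => /eqP ->.
  by rewrite -sumrN; apply: eq_bigr => i _; rewrite mulNr.
move: (ch) => /mkseq_genP[b chE] i; rewrite ltnS leq_eqVlt => /predU1P[->|ih].
  exact: mkseq_gen_le ch.
have e1 : \sum_(i < h) (c i + b i * r h) * r i = 0.
  rewrite -[RHS]e chE mulr_suml -big_split; apply: eq_bigr => j _ /=.
  by rewrite mulrDl mulrAC.
rewrite -[c i](addrK (b i * r h)); apply: linB; first exact: gen_lin.
  by apply: mkseq_gen_le (leqnSn h) _; apply: (IH (fun i => c i + b i * r h)) => //; apply: ltnW.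
by apply: linMl; [exact: gen_lin|exact: mkseq_gen_mem].
Qed.

(** The terms that involve the last member are its product with a linear
combination [w]. By regularity [w] lies in the square of the ideal [J h] of the
earlier members. So [linear_syzygy] applies to the coefficients of [w], and
rewriting [w] with coefficients in [J h] leaves a quadratic relation among the
earlier members, with coefficients changed only by multiples of the last
member. *)
Lemma quadratic_syzygy h (d : nat -> nat -> R) : (h <= n)%N ->
    \sum_(i < h) (\sum_(j < h) d i j * r j) * r i = 0 ->
  forall i j, (i < h)%N -> (j < h)%N ->
    d i i \in J h /\ (i != j -> d i j + d j i \in J h).
Proof.
elim: h d => // h IH d hn; rewrite big_ord_recr /= => e.
have Jl h' := gen_lin (mkseq r h').
pose w := \sum_(i < h) (d i h + d h i) * r i + d h h * r h.
have e1 : \sum_(i < h) (\sum_(j < h) d i j * r j) * r i + r h * w = 0.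
  rewrite -[RHS]e big_ord_recr /= /w mulrDr mulr_sumr.
  under [X in _ = X + _]eq_bigr do rewrite big_ord_recr /= mulrDl.
  rewrite big_split /= -!addrA; congr (_ + _).
  rewrite mulrDl [RHS]addrA mulr_suml -big_split /= mulrC -[RHS]addrC [LHS]addrC.
  congr (_ + _); apply: eq_bigr => i _; ring.
have /mkseq_genP[w' wE] : w \in J h.
  apply: reg => //; apply/mkseq_genP; exists (fun i => - \sum_(j < h) d i j * r j).
  move/eqP: e1; rewrite addrC addr_eq0 => /eqP ->.
  by rewrite -sumrN; apply: eq_bigr => i _; rewrite mulNr.
have w'J i : (i < h)%N -> w' i \in J h.
  move=> ih; apply: reg => //.
  have h1 : \sum_(j < h) d i j * r j \in J h by apply/mkseq_genP; exists (d i).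
  rewrite -(linDr (Jl h) _ h1).
  have e2 : \sum_(i < h) (r h * w' i + \sum_(j < h) d i j * r j) * r i = 0.
    rewrite -[RHS]e1 wE mulr_sumr addrC -big_split /=.
    by apply: eq_bigr => k _; rewrite mulrDl mulrA.
  exact: (linear_syzygy (c := fun i => r h * w' i + \sum_(j < h) d i j * r j)
    (ltnW hn) e2 ih).
have [b bE] : exists b : nat -> nat -> R, forall i, (i < h)%N ->
    w' i = \sum_(j < h) b i j * r j.
  suff /boolp.choice[b bE] : forall i, exists c : nat -> R,
      (i < h)%N -> w' i = \sum_(j < h) c j * r j by exists b.
  move=> i; have [/w'J/mkseq_genP[c ->]|_] := ltnP i h; first by exists c.
  by exists (fun=> 0).
have last_col i : (i < h)%N -> d i h + d h i \in J h.+1 /\ d h h \in J h.+1.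
  move=> ih.
  pose c i := if (i < h)%N then d i h + d h i - w' i else d h h.
  have cJ : \sum_(i < h.+1) c i * r i = 0.
    have e2 : w - \sum_(i < h) w' i * r i = 0 by rewrite -wE subrr.
    rewrite big_ord_recr /= /c ltnn -[RHS]e2 /w addrAC -sumrB; congr (_ + _).
    by apply: eq_bigr => j _; rewrite ltn_ord mulrBl.
  split; last by have := linear_syzygy hn cJ (ltnSn h); rewrite /c ltnn.
  have := linear_syzygy hn cJ (ltnW ih); rewrite /c ih (linBr (Jl _)) //.
  exact: mkseq_gen_le (w'J i ih).
have inner : \sum_(i < h) (\sum_(j < h) (d i j + r h * b i j) * r j) * r i = 0.
  rewrite -[RHS]e1 wE mulr_sumr -big_split; apply: eq_bigr => i _ /=.
  rewrite bE // mulrA -mulrDl; congr (_ * _).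
  rewrite mulr_sumr -big_split; apply: eq_bigr => j _ /=.
  by rewrite mulrDl mulrA.
have rhJ x : r h * x \in J h.+1 by apply: linMr => //; apply: mkseq_gen_mem.
have up x : x \in J h -> x \in J h.+1 by apply: mkseq_gen_le.
have dd i : (i < h)%N -> d i i \in J h.+1.
  move=> ih; have [/up] := IH (fun i j => d i j + r h * b i j) (ltnW hn) inner i i ih ih.
  by rewrite (linDr (Jl _) _ (rhJ _)).
have dij i j : (i < h)%N -> (j < h)%N -> i != j -> d i j + d j i \in J h.+1.
  move=> ih jh ij; have [_ /(_ ij)/up] := IH (fun i j => d i j + r h * b i j) (ltnW hn) inner i j ih jh.
  by rewrite addrACA -mulrDr (linDr (Jl _) _ (rhJ _)).
have dhh : d h h \in J h.+1.
  have [h0|hpos] := posnP h; last by have [] := last_col 0%N hpos.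
  move: e hn; rewrite h0 !big_ord1 !big_ord0 !add0r => e hn.
  apply: (mkseq_gen_le (h := 0)) => //; apply: reg => //; apply: reg => //.
  by rewrite mulrC (mulrC (r 0%N)) e (lin0 (Jl _)).
have ltnSP k : (k < h.+1)%N -> k = h \/ (k < h)%N.
  by rewrite ltnS leq_eqVlt => /predU1P.
move=> i j /ltnSP[->|ih] /ltnSP[->|jh].
- by split=> [|/eqP/(_ erefl)[]]; exact: dhh.
- by split=> [|_]; [exact: dhh|rewrite addrC; exact: (last_col j jh).1].
- by split=> [|_]; [exact: dd|exact: (last_col i ih).1].
- by split; [exact: dd|exact: dij].
Qed.

(** A product of two combinations of a regular sequence can vanish only if
one of them has all coefficients in [P], because a product of two linear
forms over a domain vanishes only if one of them does. *)
Lemma product_syzygy (P : {pred R}) (c a : nat -> R) :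
    prime_ideal P -> (forall i, (i < n)%N -> r i \in P) ->
    (\sum_(i < n) c i * r i) * (\sum_(i < n) a i * r i) = 0 ->
  (forall i, (i < n)%N -> c i \in P) \/ (forall i, (i < n)%N -> a i \in P).
Proof.
move=> [/idealr_linear Pl Ppr] rP e.
have JP : {subset J n <= P}.
  apply: gen_sub => // x /mapP[i]; rewrite mem_iota => /andP[_ ?] ->; exact: rP.
have e1 : \sum_(i < n) (\sum_(j < n) c i * a j * r j) * r i = 0.
  rewrite -[RHS]e mulr_suml; apply: eq_bigr => i _.
  rewrite mulrAC; congr (_ * _); rewrite mulr_sumr.
  by apply: eq_bigr => j _; rewrite mulrA.
have H i j ih jh := quadratic_syzygy (d := fun i j => c i * a j) (leqnn n) e1 (i := i) (j := j) ih jh.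
have [|nc] := EM (forall i, (i < n)%N -> c i \in P); first by left.
have [|na] := EM (forall i, (i < n)%N -> a i \in P); first by right.
have top b : ~ (forall i, (i < n)%N -> b i \in P) -> exists2 i, (i < n)%N &
    b i \notin P /\ forall j, (j < n)%N -> (i < j)%N -> b j \in P.
  move=> nb; pose p i := (i < n)%N && (b i \notin P).
  have pex : exists i, p i.
    apply: contra_notP nb => /forallNP pn i ih; apply: contraT => bi.
    by case: (pn i); rewrite /p ih.
  have pub i : p i -> (i <= n)%N by case/andP => /ltnW.
  case: (ex_maxnP pex pub) => i /andP[ih bi] imax; exists i => //; split=> // j jh ij.
  by apply: contraLR ij => bj; rewrite -leqNgt; apply: imax; rewrite /p jh.
have [i ih [ci ci']] := top c nc; have [j jh [aj aj']] := top a na.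
have no : c i * a j \notin P.
  by apply/negP => /Ppr /orP[]; apply/negP.
case/negP: no; case: (ltngtP i j) => ij.
- have [_ /(_ (negbT (ltn_eqF ij)))/JP] := H i j ih jh.
  by rewrite (linDr Pl) //; apply: (linMr Pl); apply: ci'.
- have [_ /(_ (negbT (gtn_eqF ij)))/JP] := H i j ih jh.
  by rewrite (linDr Pl) //; apply: (linMl Pl); apply: aj'.
- by have [/JP] := H i i ih ih; rewrite {2}ij.
Qed.

End QuasiRegular.
(** * A criterion for failing to be Cohen--Macaulay *)

Lemma ideal_quotient_map (S : comNzRingType) (I : idealr S) :
  exists pi : {rmorphism S -> {ideal_quot I}},
    (forall x, exists t, pi t = x) /\ (forall t, (pi t == 0) = (t \in I)).
Proof.
exists \pi_({ideal_quot I})%qT; split=> [x|t].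
  by exists (repr x); apply: reprK.
rewrite -[in RHS](subr0 t) Quotient.idealrBE.
by rewrite -[X in _ == X](rmorph0 \pi_({ideal_quot I})%qT).
Qed.

Section SetMonomials.
Variables (K : fieldType) (N : nat).
Local Notation S := {mpoly K[N]}.
Implicit Types (E : {set 'I_N}) (i : 'I_N) (t : S).

Definition set_mnm E : 'X_{1..N} := [multinom (i \in E : nat) | i < N].

Lemma monE E : mon K E = 'X_[set_mnm E].
Proof.
rewrite /mon mprodXE; congr 'X_[_]; apply/mnmP => i; rewrite mnm_sumE mnmE.
have [iE|iE] := boolP (i \in E).
  rewrite (bigD1 i) //= mnm1E eqxx big1 // => j /andP[_ ne].
  by rewrite mnm1E (negbTE ne).
by rewrite big1 // => j jE; rewrite mnm1E; case: eqP iE => // <-; rewrite jE.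
Qed.

Variable Z : {set 'I_N}.

(** The point whose zero coordinates are those in [Z]: near it, the ideal
generated by the [mon E] is generated by the [mon (E :&: Z)]. *)
Definition zero_one_point i : K := if i \in Z then 0 else 1.
Local Notation p := zero_one_point.

Lemma meval_mon E : E :&: Z != set0 -> (mon K E).@[p] = 0.
Proof.
case/set0Pn => i; rewrite inE => /andP[iE iZ].
by rewrite /mon rmorph_prod (bigD1 i) //= mevalXU /p iZ mul0r.
Qed.

(** The coefficient of ['X_i] in the linear part of [t] at the point. *)
Definition tangent i t : K := (t^`M(i)).@[p].

Lemma tangentM i t t' : tangent i (t * t') = tangent i t * t'.@[p] + t.@[p] * tangent i t'.
Proof. by rewrite /tangent mderivM mevalD !mevalM. Qed.

Lemma tangentD i t t' : tangent i (t + t') = tangent i t + tangent i t'.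
Proof. by rewrite /tangent mderivD mevalD. Qed.

Lemma tangent_sum i (k : nat) (f : 'I_k -> S) :
  tangent i (\sum_(j < k) f j) = \sum_(j < k) tangent i (f j).
Proof.
by apply: (big_morph (tangent i) (@tangentD i)); rewrite /tangent raddf0 meval0.
Qed.

Lemma tangent_mon i E : E :&: Z != set0 -> E :&: Z != [set i] ->
  tangent i (mon K E) = 0.
Proof.
move=> EZ0 EZi; rewrite /tangent monE mderivX mevalZ mnmE.
have [iE|] := boolP (i \in E); last by rewrite mul0r.
have [j jEZ ji] : exists2 j, j \in E :&: Z & j != i.
  apply/exists_inP; apply: contraNT EZi => /exists_inPn h.
  apply/eqP/setP => j; rewrite in_set1; apply/idP/eqP => [/h/negPn/eqP//|->].
  case/set0Pn: EZ0 => j' j'EZ; have := h j' j'EZ.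
  by rewrite negbK => /eqP <-.
move: jEZ; rewrite inE => /andP[jE jZ].
rewrite mevalX (bigD1 j) //= mnmBE mnmE jE mnm1E eq_sym (negbTE ji).
by rewrite /p jZ mul0r mulr0.
Qed.

(** A multiple of [mon K E] has a term linear in ['X_i] at the point only if
['X_i] is the one variable of [mon K E] that vanishes there. *)
Lemma tangent_gen (Es : seq {set 'I_N}) i t :
    (forall E, E \in Es -> E :&: Z != set0) ->
    (forall E, E \in Es -> E :&: Z != [set i]) ->
    t \in gen_ideal [seq mon K E | E <- Es] ->
  t.@[p] = 0 /\ tangent i t = 0.
Proof.
elim: Es t => [|E Es IH] t h0 hi.
  by rewrite gen_nil => /eqP ->; rewrite /tangent !rmorph0 raddf0 rmorph0.
case/gen_consP => a h; have [E' E's|E' E's|t0 ti] := IH _ _ _ h.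
- by apply: h0; rewrite inE E's orbT.
- by apply: hi; rewrite inE E's orbT.
have hE := mem_head E Es; rewrite -[t](subrK (a * mon K E)); split.
  by rewrite mevalD mevalM t0 (meval_mon (h0 _ hE)) mulr0 addr0.
rewrite tangentD ti add0r tangentM (meval_mon (h0 _ hE)).
by rewrite tangent_mon ?h0 ?hi // !mulr0 addr0.
Qed.

End SetMonomials.

Section Criterion.
Variables (K : fieldType) (N : nat) (R : comNzRingType).
Local Notation S := {mpoly K[N]}.
Variables (pi : {rmorphism S -> R}) (Es : seq {set 'I_N}).
Variables (A B Z : {set 'I_N}) (y a : 'I_N).
Hypotheses (pi_surj : forall x, exists t, pi t = x)
  (pi_ker : forall t, (pi t == 0) = (t \in gen_ideal [seq mon K E | E <- Es])).
Hypotheses (AZ : A \subset Z) (yZ : y \in Z) (aZ : a \in Z) (aB : a \in B)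
  (AB : (#|A| < #|B|)%N)
  (A_hits : forall E, E \in Es -> E :&: A != set0)
  (B_link : forall v, v \in B ->
     exists2 E, E \in Es & E :&: Z \subset [set v; y])
  (y_alone : forall E, E \in Es -> E :&: Z != [set y])
  (a_alone : forall E, E \in Es -> E :&: Z != [set a]).

Local Notation p := (zero_one_point K Z).
Local Notation u0 := ('X_[set_mnm (y |: ~: Z)] : S).

Let Z_hits E : E \in Es -> E :&: Z != set0.
Proof.
move=> /A_hits/set0Pn[i]; rewrite inE => /andP[iE iA].
by apply/set0Pn; exists i; rewrite inE iE (subsetP AZ).
Qed.

Let u0_mul (m : 'X_{1..N}) v : v \in B -> m v != 0%N -> pi ('X_[m] * u0) = 0.
Proof.
move=> vB mv; apply/eqP; rewrite pi_ker -mpolyXD.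
have [E EEs EZ] := B_link vB; have [|t ->] := @mon_dvd K N E (m + set_mnm (y |: ~: Z)).
  apply/subsetP => i iE; rewrite inE mnmDE mnmE !inE addn_eq0 negb_and eqb0 negbK.
  have [iZ|] := boolP (i \in Z); last by rewrite !orbT.
  have : i \in [set v; y] by apply: (subsetP EZ); rewrite inE iE.
  by rewrite !inE => /orP[/eqP ->|->]; rewrite ?mv ?orbT.
by apply: linMl; [exact: gen_lin|apply: gen_mem; apply: map_f].
Qed.

(** Consider the point with zero coordinates in [Z] and the others equal to 1.
The monomials vanish on the linear space given by [A], and a chain of primes
there bounds the height at the point from below by [N - #|A|]. The product [u]
of ['X_y] with the variables outside [Z] is killed by ['X_v] for [v] in [B], so
it is supported on the linear space given by [B], which has smaller dimension.
Any [N - #|B| + 1] elements satisfy a relation on that space. If they form a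
regular sequence in the maximal ideal [P] of the point, the relation forces [u]
into the ideal that they generate. As [u] has a linear term at the point, it
is a combination of the sequence with some coefficient [b i] outside [P]. Since
['X_a * u = 0] and the coefficients of a relation lie in that ideal, it
contains [b i * 'X_a], again as a combination with a coefficient outside [P].
But the product of these two combinations is zero. *)
Lemma not_cohen_macaulay : ~ cohen_macaulay R.
Proof.
case=> _ CM.
pose kap : {rmorphism K -> K} := idfun.
pose ev : {rmorphism S -> K} := meval p.
have evE t : point_eval kap p t = t.@[p] by [].
have ev_ker t : pi t = 0 -> ev t = 0.
  move/eqP; rewrite pi_ker => tI.
  by have [] := tangent_gen Z_hits y_alone tI.
have [psi psiE] := factor_rmorphism pi_surj ev_ker.
pose P : {pred R} := [pred x | psi x == 0].
have PE t : (pi t \in P) = (t.@[p] == 0) by rewrite inE psiE.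
have Ppr : prime_ideal P by apply: kernel_prime.
have [|d [[[s [szs sP [s1 sreg]]] _] [_ dmax]]] := CM P.
  apply: (point_maximal (kap := kap) (a := p) pi_surj PE) => c.
  by exists c%:MP; rewrite evE mevalC.
have Ad : (N - #|A| <= d)%N.
  apply/dmax/(point_chain (kap := kap) pi_surj _ _ PE) => [t|i].
    move/eqP; rewrite pi_ker; apply: contraTeq => t0.
    apply/negP => /(gen_sub (I := [pred t | specialization kap p A t == 0])) h.
    case/negP: t0; apply: h => [|_ /mapP[E /A_hits/set0Pn[i iEA] ->]].
      exact/idealr_linear/(kernel_prime (specialization kap p A)).1.
    move: iEA; rewrite !inE => /andP[iE iA].
    rewrite /mon rmorph_prod (bigD1 i) //= specializationX iA.
    by rewrite /zero_one_point (subsetP AZ) // mpolyC0 mul0r.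
  exists ('X - (p i)%:P); first by rewrite polyXsubC_eq0.
  by rewrite map_poly_id // hornerXsubC subrr.
have BN : (#|B| <= N)%N by rewrite -[X in (_ <= X)%N]card_ord max_card.
pose k := (N - #|B|).+1; pose rs := take k s.
have szrs : size rs = k.
  by rewrite size_takel // szs; apply: leq_trans Ad; rewrite /k; lia.
have rsreg : weakly_regular rs by apply: weakly_regular_take.
have rsP i : (i < k)%N -> rs`_i \in P.
  by move=> ik; apply: sP; apply: (@mem_take k); apply: mem_nth; rewrite szrs.
have [sec secK] := boolp.choice pi_surj.
have rsK : map pi (map sec rs) = rs.
  by rewrite -map_comp map_id_in // => x _ /=.
have [j||t [c [nz c0]]] := @algebraic_relation K N (N - #|B|) unit (fun=> ~: B) (map sec rs).
- by rewrite cardsCs setCK card_ord.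
- by rewrite size_map.
have {nz}nz : exists2 e, e \in exponents t rs & c e != 0.
  by case: nz => e he ce; exists e; rewrite // inE -(size_map sec).
pose u := pi u0.
have uJ : u \in gen_ideal rs.
  apply: (regular_relation (kap := pi \o @mpolyC N K) rsreg nz).
  rewrite -[X in poly_value _ _ _ X]rsK -poly_value_map /u -rmorphM.
  apply/eqP; rewrite pi_ker; apply: linear_msupp => [|m mF]; first exact: gen_lin.
  have /subsetPn[v] : ~~ (mnm_support m \subset ~: B).
    by apply: contraTN mF => h; rewrite -mcoeff_eq0 (c0 m tt h).
  by rewrite !inE negbK => mv vB; rewrite -pi_ker (u0_mul vB).
(* membership in [P] of all coefficients would make the linear part vanish *)
have lin_part i x (b : nat -> R) : i \in Z ->
    (forall E, E \in Es -> E :&: Z != [set i]) ->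
    pi x = \sum_(j < k) b j * rs`_j -> tangent Z i x != 0 ->
    ~ (forall j, (j < k)%N -> b j \in P).
  move=> iZ i_alone e; apply: contraNnot => bP.
  have /eqP : pi (x - \sum_(j < k) sec (b j) * sec rs`_j) = 0.
    rewrite rmorphB rmorph_sum e; apply/eqP; rewrite subr_eq0; apply/eqP.
    by apply: eq_bigr => j _; rewrite rmorphM !secK.
  rewrite pi_ker => /(tangent_gen Z_hits i_alone)[_ tx].
  rewrite -[x](subrK (\sum_(j < k) sec (b j) * sec rs`_j)) tangentD tx add0r.
  rewrite tangent_sum big1 // => j _; rewrite tangentM.
  have /eqP -> : (sec rs`_j).@[p] == 0 by rewrite -PE secK rsP.
  have /eqP -> : (sec (b j)).@[p] == 0 by rewrite -PE secK bP.
  by rewrite mulr0 mul0r addr0.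
have JE : gen_ideal rs = gen_ideal (mkseq (nth 0 rs) k).
  by rewrite -szrs mkseq_nth.
have reg i x : (i < k)%N -> rs`_i * x \in gen_ideal (mkseq (nth 0 rs) i) ->
    x \in gen_ideal (mkseq (nth 0 rs) i).
  move=> ik; have -> : mkseq (nth 0 rs) i = take i rs.
    by rewrite -[in RHS](mkseq_nth 0 rs) szrs /mkseq -map_take take_iota (minn_idPl (ltnW ik)).
  by apply: rsreg; rewrite szrs.
move: (uJ); rewrite JE => /mkseq_genP[b uE].
have /existsNP[i /not_implyP[ik /negP bi]] : ~ forall j, (j < k)%N -> b j \in P.
  apply: (lin_part y u0) => //.
  rewrite /tangent mderivX mevalZ mnmE !inE eqxx mul1r mevalX.
  rewrite big1 ?oner_eq0 // => i _; rewrite mnmBE mnmE !inE mnm1E.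
  rewrite /zero_one_point; case: (boolP (i \in Z)) => iZ; last by rewrite expr1n.
  by rewrite eq_sym; case: (y == i); rewrite subnn.
have ua : u * pi 'X_a = 0.
  by rewrite mulrC /u -rmorphM (u0_mul aB) // mnm1E eqxx.
have : b i * pi 'X_a \in gen_ideal (mkseq (nth 0 rs) k).
  apply: (linear_syzygy reg (c := fun i => b i * pi 'X_a)) => //.
  by rewrite -[RHS]ua uE mulr_suml; apply: eq_bigr => j _; rewrite mulrAC.
case/mkseq_genP => c' cE.
have : ~ forall j, (j < k)%N -> c' j \in P.
  apply: (lin_part a (sec (b i) * 'X_a)) => //; first by rewrite rmorphM secK.
  rewrite tangentM mevalXU /zero_one_point aZ mulr0 add0r.
  rewrite /tangent mderivX mnm1E eqxx scale1r mevalX.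
  rewrite [X in _ * X]big1 ?mulr1 => [|j _]; last by rewrite mnmBE subnn.
  by rewrite -PE secK.
have [|bP|//] := product_syzygy reg Ppr rsP (c := b) (a := c').
  by rewrite -uE -cE mulrCA ua mulr0.
by move=> _; apply: (negP bi); apply: bP.
Qed.

End Criterion.
(** * Closed neighborhood ideals *)

Section Graph.
Variables (K : fieldType) (V : finType) (e : rel V).
Local Notation nbhd := (closed_neighborhood e).

Lemma nbhd_monomialE u : nbhd_monomial K e u = mon K (enum_rank @: nbhd u).
Proof. by rewrite /nbhd_monomial /mon big_imset //= => i j _ _ /enum_rank_inj. Qed.

Definition nbhd_ranks : seq {set 'I_#|V|} := [seq enum_rank @: nbhd u | u <- enum V].

Lemma NI_gen t : (t \in NI K e) = (t \in gen_ideal [seq mon K E | E <- nbhd_ranks]).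
Proof.
rewrite /nbhd_ranks -map_comp (eq_map (g := nbhd_monomial K e)) // => u.
by rewrite nbhd_monomialE.
Qed.

Lemma NI_not_cohen_macaulay (A B Z : {set V}) (y a : V) :
    A \subset Z -> y \in Z -> a \in Z -> a \in B -> (#|A| < #|B|)%N ->
    (forall u, nbhd u :&: A != set0) ->
    (forall v, v \in B -> exists u, nbhd u :&: Z \subset [set v; y]) ->
    (forall u, nbhd u :&: Z != [set y]) ->
    (forall u, nbhd u :&: Z != [set a]) ->
  ~ cohen_macaulay_ideal (NI K e).
Proof.
move=> AZ yZ aZ aB AB A_hits B_link y_alone a_alone.
have [pi [pi_surj pi_ker]] := ideal_quotient_map (NI K e).
have rI (X Y : {set V}) : (enum_rank @: X) :&: (enum_rank @: Y) = enum_rank @: (X :&: Y).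
  by rewrite imsetI // => ? ? _ _ /enum_rank_inj.
have r1 v : [set enum_rank v] = enum_rank @: [set v] by rewrite imset_set1.
have r_inj : injective (fun X : {set V} => enum_rank @: X) by apply/imset_inj/enum_rank_inj.
apply: (not_cohen_macaulay (K := K) (pi := pi) (Es := nbhd_ranks)
  (A := enum_rank @: A) (B := enum_rank @: B) (Z := enum_rank @: Z)
  (y := enum_rank y) (a := enum_rank a)) => //.
- by move=> t; rewrite pi_ker NI_gen.
- exact: imsetS.
- exact: imset_f.
- exact: imset_f.
- exact: imset_f.
- by rewrite !card_imset //; apply: enum_rank_inj.
- by move=> _ /mapP[u _ ->]; rewrite rI imset_eq0.
- move=> _ /imsetP[v /B_link[u uZ] ->].
  exists (enum_rank @: nbhd u); first by apply/map_f; rewrite mem_enum.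
  by rewrite rI -!imset_set1 -imsetU; apply: imsetS.
- by move=> _ /mapP[u _ ->]; rewrite rI r1 (inj_eq r_inj).
- by move=> _ /mapP[u _ ->]; rewrite rI r1 (inj_eq r_inj).
Qed.

End Graph.

(** * Double brooms whose handle does not have four vertices *)

Section Broom.
Variables (K : fieldType) (n m s : nat).
Local Notation V := (broom_vertex n m s).
Local Notation nbhd := (closed_neighborhood (@double_broom_square n m s)).
Local Notation x i := (inl i : V).
Local Notation y j := (inr (inl j) : V).
Local Notation z r := (inr (inr r) : V).

Lemma vertex_eqE (u v : V) : (u == v) =
  match u, v with
  | inl i, inl j => i == j :> nat
  | inr (inl i), inr (inl j) => i == j :> nat
  | inr (inr i), inr (inr j) => i == j :> nat
  | _, _ => false
  end.
Proof. by case: u v => [i|[i|i]] [j|[j|j]]. Qed.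

Lemma nbhdE (u v : V) : (v \in nbhd u) =
  match u, v with
  | inl _, inl _ | inr (inr _), inr (inr _) => true
  | inl _, inr (inl j) | inr (inl j), inl _ => (j < 2)%N
  | inr (inl j), inr (inl k) => (j <= k + 2)%N && (k <= j + 2)%N
  | inr (inl j), inr (inr _) | inr (inr _), inr (inl j) => (m <= j + 2)%N
  | _, _ => false
  end.
Proof.
rewrite !inE vertex_eqE /double_broom_square /double_broom.
by case: u v => [i|[i|i]] [j|[j|j]] //=;
  have := ltn_ord i; have := ltn_ord j; lia.
Qed.

Hypotheses (n0 : (0 < n)%N) (s0 : (0 < s)%N).
Local Notation x0 := (x (Ordinal n0)).
Local Notation z0 := (z (Ordinal s0)).

(** Near the point where just [x0], [z0] and the last but one vertex [w] of the
handle vanish, the ideal is [(w * x0, w * z0)]: a hyperplane and a linear space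
of codimension two. *)
Lemma short_handle_not_cohen_macaulay : (2 <= m <= 3)%N ->
  ~ cohen_macaulay_ideal (NI K (@double_broom_square n m s)).
Proof.
move=> /andP[m2 m3]; have ym : (m - 2 < m)%N by lia.
pose w := y (Ordinal ym).
have wN u : w \in nbhd u.
  by rewrite nbhdE; case: u => [i|[i|i]] /=; have := ltn_ord i; lia.
apply: (@NI_not_cohen_macaulay K V _ [set w] [set x0; z0] (w |: [set x0; z0]) w x0).
- by rewrite subsetUl.
- by rewrite !inE eqxx.
- by rewrite !inE eqxx orbT.
- by rewrite !inE eqxx.
- by rewrite cards1 cards2.
- by move=> u; apply/set0Pn; exists w; rewrite in_setI wN in_set1 eqxx.
- move=> v vB; exists v; apply/subsetP => u; rewrite in_setI nbhdE => /andP[uv].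
  move: vB uv; rewrite !(in_setU1, in_set1) !vertex_eqE /w.
  case: u v => [i|[i|i]] [j|[j|j]] //=; lia.
- move=> u; apply/negP => /eqP/setP h.
  have := h x0; have := h z0; rewrite !(in_setI, nbhdE) !(in_setU1, in_set1).
  by rewrite !vertex_eqE /w; case: u {h} => [i|[i|i]] //=; have := ltn_ord i; lia.
- move=> u; apply/negP => /eqP/setP/(_ w).
  by rewrite in_setI wN in_setU1 eqxx in_set1 vertex_eqE.
Qed.

(** Besides the last but one vertex [w] of the handle, its predecessor [b] and
a leaf [z0] at the far end, the vertices at distance 5, 10, ... before the end
of the handle vanish: exactly one of them is in each run of five vertices that
ends before [w], so that they make the generators of these runs superfluous.
When none of them is within distance two of the leaves at the near end, one of
these leaves has to vanish too. The local ideal is generated by the variables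
of all these further vertices in [T], by [w * b] and by [w * z0]. *)
Lemma long_handle_not_cohen_macaulay : (5 <= m)%N ->
  ~ cohen_macaulay_ideal (NI K (@double_broom_square n m s)).
Proof.
move=> m5; have wm : (m - 2 < m)%N by lia.
have bm : (m - 3 < m)%N by lia.
pose w := y (Ordinal wm); pose b := y (Ordinal bm).
pose T : {set V} := [set v : V | match v with
  | inl i => [&& i == 0%N :> nat, m %% 5 != 1 & m %% 5 != 2]%N
  | inr (inl j) => ((j + 1) %% 5 == m %% 5)%N && (j + 6 <= m)%N
  | _ => false
  end].
pose A := w |: T; pose B := z0 |: (b |: T); pose Z := z0 |: (b |: (w |: T)).
have ZE v : (v \in Z) = match v with
  | inl i => [&& i == 0%N :> nat, m %% 5 != 1 & m %% 5 != 2]%N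
  | inr (inl j) => [|| j + 3 == m, j + 2 == m |
                      ((j + 1) %% 5 == m %% 5) && (j + 6 <= m)]%N
  | inr (inr r) => r == 0%N :> nat
  end.
  rewrite !inE !vertex_eqE; case: v => [i|[i|i]] //=; first by have := ltn_ord i; lia.
  by rewrite orbF.
have wZ : w \in Z by rewrite ZE /=; lia.
have bZ : b \in Z by rewrite ZE /=; lia.
have zZ : z0 \in Z by rewrite ZE.
apply: (@NI_not_cohen_macaulay K V _ A B Z w z0) => //.
- by apply/subsetP => v; rewrite !inE => ->; rewrite !orbT.
- by rewrite !inE eqxx.
- have wT : w \notin T by rewrite inE /=; lia.
  have bT : b \notin T by rewrite inE /=; lia.
  have zT : z0 \notin b |: T by rewrite !inE vertex_eqE.
  by rewrite !cardsU1 wT bT zT.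
- move=> u; apply/set0Pn.
  have hit v : v \in nbhd u -> v \in A -> exists v, v \in nbhd u :&: A.
    by move=> h1 h2; exists v; rewrite in_setI h1 h2.
  have hit_y k (km : (k < m)%N) : y (Ordinal km) \in nbhd u ->
      ((k + 1) %% 5 == m %% 5)%N && (k + 6 <= m)%N -> exists v, v \in nbhd u :&: A.
    by move=> h1 h2; apply: hit h1 _; rewrite !inE /= h2 orbT.
  have wA : w \in A by rewrite !inE eqxx.
  have left : (forall i, x i \in nbhd u) -> (forall k (km : (k < m)%N), (k < 2)%N ->
      y (Ordinal km) \in nbhd u) -> exists v, v \in nbhd u :&: A.
    move=> hx hy; have [mm|mm] := boolP ((m %% 5 == 1) || (m %% 5 == 2))%N.
      have km : (m %% 5 - 1 < m)%N by lia.
      by apply: (hit_y _ km); [apply: hy; lia|lia].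
    by apply: (hit x0 (hx _)); rewrite !inE /=; lia.
  case: u hit hit_y left => [i|[j|r]] hit hit_y left.
  + by apply: left => [i'|k km k2]; rewrite nbhdE.
  + have [j1|j2] := ltnP j 2.
      apply: left => [i'|k km k2]; rewrite nbhdE /=; lia.
    have [jw|jw] := leqP m (j + 4).
      by apply: (hit w) => //; rewrite nbhdE /=; have := ltn_ord j; lia.
    (* the member of [T] in the run of five vertices centered at [j] *)
    have km : (j - 2 + (m - (j - 1)) %% 5 < m)%N by lia.
    by apply: (hit_y _ km); [rewrite nbhdE /=; lia|lia].
  + by apply: (hit w) => //; rewrite nbhdE /=; lia.
- have y_link u v : (forall v', v' \in nbhd u -> v' \in Z -> (v' == v) || (v' == w)) ->
      exists u, nbhd u :&: Z \subset [set v; w].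
    move=> h; exists u; apply/subsetP => v'; rewrite in_setI => /andP[h1 h2].
    by rewrite in_set2; apply: h.
  move=> v; rewrite !inE => /or3P[/eqP->|/eqP->|].
  + apply: (y_link z0) => v'; rewrite nbhdE ZE !vertex_eqE /w.
    by case: v' => [i|[i|i]] //=; lia.
  + apply: (y_link b) => v'; rewrite nbhdE ZE !vertex_eqE /w /b.
    by case: v' => [i|[i|i]] //=; have := ltn_ord i; lia.
  case: v => [i|[j|//]] /=.
    move=> h; apply: (y_link x0) => v'; rewrite nbhdE ZE !vertex_eqE /w.
    by case: v' => [i'|[i'|i']] //=; lia.
  move=> /andP[jm j6].
  have [j2|j2] := ltnP j 2.
    apply: (y_link x0) => v'; rewrite nbhdE ZE !vertex_eqE /w.
    by case: v' => [i'|[i'|i']] //=; lia.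
  (* a run with [j] as its last vertex, or the first run *)
  pose k := if (j < 4)%N then 2 else (j - 2)%N.
  have km : (k < m)%N by rewrite /k; case: ifP; lia.
  apply: (y_link (y (Ordinal km))) => v'; rewrite nbhdE ZE !vertex_eqE /w /k.
  by case: v' => [i'|[i'|i']] //=; case: ifP; lia.
- move=> u; apply/negP => /eqP/setP h.
  have := h w; have := h b; have := h z0.
  rewrite !in_setI !in_set1 wZ bZ zZ !andbT !nbhdE !vertex_eqE /w /b.
  by case: u {h} => [i|[i|i]] //=; have := ltn_ord i; lia.
- move=> u; apply/negP => /eqP/setP h.
  have := h w; have := h z0.
  rewrite !in_setI !in_set1 wZ zZ !andbT !nbhdE !vertex_eqE /w.
  by case: u {h} => [i|[i|i]] //=; have := ltn_ord i; lia.
Qed.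

End Broom.
(** * Noetherian rings *)

Section Noetherian.
Implicit Types (A R : comNzRingType).

Lemma noetherian_gen R (I : {pred R}) :
  noetherian R -> linear_pred I -> exists s, I =i gen_ideal s.
Proof.
move=> nR Il; have [I1|I1] := boolP (1 \in I).
  exists [:: 1] => x; rewrite -[x]mulr1 (linMl Il) //.
  by apply/esym/linMl; [exact: gen_lin|apply/gen_mem/mem_head].
by apply: nR; apply: linear_idealr.
Qed.

Lemma noetherian_field (F : fieldType) : noetherian F.
Proof.
move=> I [I0 I1 Il]; exists [::] => x; rewrite gen_nil.
apply/idP/eqP => [xI|-> //]; apply/eqP/(contraNT _ I1) => x0.
by rewrite -(mulVf x0) -[_ * _]addr0 Il.
Qed.

Lemma noetherian_surj A R (phi : {rmorphism A -> R}) :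
  (forall y, exists x, phi x = y) -> noetherian A -> noetherian R.
Proof.
move=> surj nA I /idealr_linear Il.
have [s sE] := noetherian_gen nA (preim_linear phi Il).
exists (map phi s) => y; apply/idP/idP => [yI|].
  have [x xy] := surj y; rewrite -xy; apply: gen_map.
  by rewrite -sE inE xy.
by case/(gen_map_surj surj) => x; rewrite -sE inE => xI <-.
Qed.

Lemma lift_seq (T U : eqType) (g : T -> U) (Q : T -> Prop) (cs : seq U) :
    (forall c, c \in cs -> exists2 f, Q f & g f = c) ->
  exists2 fs, (forall f, f \in fs -> Q f) & map g fs = cs.
Proof.
elim: cs => [_|c cs IH h]; first by exists [::].
have [f Qf gf] := h c (mem_head _ _).
have [|fs Qfs gfs] := IH; first by move=> d dcs; apply: h; rewrite inE dcs orbT.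
exists (f :: fs); last by rewrite /= gf gfs.
by move=> f'; rewrite inE => /predU1P[->|/Qfs].
Qed.

Section HilbertBasis.
Variables (A : comNzRingType) (I : {pred {poly A}}).
Hypotheses (nA : noetherian A) (Il : linear_pred I).
Implicit Types (p q : {poly A}) (s : seq {poly A}) (D : nat).

(** The coefficients in degree [D] of the members of [I] of degree at most
[D]. *)
Definition leading_coefs D : {pred A} :=
  fun c => `[< exists p, [/\ p \in I, (size p <= D.+1)%N & p`_D = c] >].

Lemma leading_coefs_linear D : linear_pred (leading_coefs D).
Proof.
split=> [|a u v /asboolP[p [pI szp <-]] /asboolP[q [qI szq <-]]]; apply/asboolP.
  by exists 0; rewrite size_poly0 coef0 (lin0 Il).
exists (a%:P * p + q); split; first by rewrite linD ?linMl.
  rewrite (leq_trans (size_polyD _ _)) // geq_max szq andbT.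
  by rewrite mul_polyC (leq_trans (size_scale_leq _ _)).
by rewrite coefD coefCM.
Qed.

Lemma leading_coefs_le D D' : (D <= D')%N ->
  {subset leading_coefs D <= leading_coefs D'}.
Proof.
move=> DD' c /asboolP[p [pI szp <-]]; apply/asboolP; exists (p * 'X^(D' - D)).
split; first by rewrite linMr.
  rewrite (leq_trans (size_polyMleq _ _)) // size_polyXn.
  lia.
by rewrite coefMXn ltnNge leq_subr subKn.
Qed.

Lemma gen_leading_coef D s c :
    (forall f, f \in s -> (size f <= D.+1)%N) ->
    c \in gen_ideal [seq (f : {poly A})`_D | f <- s] ->
  exists2 q, q \in gen_ideal s & (size q <= D.+1)%N /\ q`_D = c.
Proof.
elim: s c => [|f s IH] c sz.
  rewrite gen_nil => /eqP ->; exists 0; first by rewrite gen_nil.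
  by rewrite size_poly0 coef0.
case/gen_consP => a /IH[|q qs [szq qD]].
  by move=> g gs; apply: sz; rewrite inE gs orbT.
exists (q + a%:P * f); first by apply/gen_consP; exists a%:P; rewrite addrK.
split; last by rewrite coefD coefCM qD subrK.
rewrite (leq_trans (size_polyD _ _)) // geq_max szq.
by rewrite mul_polyC (leq_trans (size_scale_leq _ _)) // sz ?mem_head.
Qed.

Lemma lift_leading_coefs D (cs : seq A) : {subset cs <= leading_coefs D} ->
  exists2 fs, (forall f, f \in fs -> f \in I /\ (size f <= D.+1)%N) &
    [seq (f : {poly A})`_D | f <- fs] = cs.
Proof.
move=> csD; apply: (lift_seq (Q := fun f => f \in I /\ (size f <= D.+1)%N)).
by move=> c /csD/asboolP[p [pI szp pD]]; exists p.
Qed.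

Lemma size_sub_lead D p q : (size p <= D.+1)%N -> (size q <= D.+1)%N ->
  p`_D = q`_D -> (size (p - q)%R <= D)%N.
Proof.
move=> szp szq pq; apply/leq_sizeP => j; rewrite leq_eqVlt coefB.
case/predU1P => [<-|Dj]; first by rewrite pq subrr.
by rewrite !nth_default ?subrr //; [apply: leq_trans szq _|apply: leq_trans szp _].
Qed.

(** Members of degree exactly [D] are reduced to smaller degree by finitely
many whose coefficients in degree [D] generate [leading_coefs D]. *)
Lemma bounded_degree_gen D :
  exists2 s, {subset s <= I} & forall p, p \in I -> (size p <= D)%N -> p \in gen_ideal s.
Proof.
elim: D => [|D [s sI sP]].
  by exists [::] => // p _; rewrite leqn0 size_poly_eq0 gen_nil.
have [cs csE] := noetherian_gen nA (leading_coefs_linear D).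
have [|fs fsP fsE] := @lift_leading_coefs D cs.
  by move=> c /gen_mem; rewrite csE.
exists (s ++ fs) => [f|p pI szp].
  by rewrite mem_cat => /orP[/sI|/fsP[]].
have : p`_D \in gen_ideal [seq (f : {poly A})`_D | f <- fs].
  by rewrite fsE -csE; apply/asboolP; exists p.
case/gen_leading_coef => [f /fsP[]//|q qfs [szq qD]].
have qI : q \in I by apply: gen_sub qfs => // f /fsP[].
apply/gen_catP; exists (p - q); last by rewrite opprB addrC subrK.
apply: sP; first exact: linB.
exact: size_sub_lead.
Qed.

(** The union of the ascending ideals [leading_coefs D] is finitely generated,
so it is reached at some [D]; members of degree at least [D] are reduced by
shifts of the generators found there. *)
Lemma hilbert_basis : exists s, I =i gen_ideal s.
Proof.
pose all_coefs : {pred A} := fun c => `[< exists D, c \in leading_coefs D >].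
have [|cs csE] := @noetherian_gen A all_coefs nA.
  split=> [|a u v /asboolP[D uD] /asboolP[D' vD']]; apply/asboolP.
    by exists 0%N; apply: lin0 (leading_coefs_linear 0).
  exists (maxn D D'); apply: (leading_coefs_linear _).2.
    exact: leading_coefs_le (leq_maxl _ _) _ uD.
  exact: leading_coefs_le (leq_maxr _ _) _ vD'.
have [D csD] : exists D, {subset cs <= leading_coefs D}.
  have : forall c, c \in cs -> c \in all_coefs by move=> c /gen_mem; rewrite csE.
  elim: (cs) => [_|c l IH h]; first by exists 0%N.
  have [|D lD] := IH; first by move=> d dl; apply: h; rewrite inE dl orbT.
  have /asboolP[D' cD'] := h c (mem_head _ _); exists (maxn D D') => d.
  rewrite inE => /predU1P[->|/lD dD].
    exact: leading_coefs_le (leq_maxr _ _) _ cD'.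
  exact: leading_coefs_le (leq_maxl _ _) _ dD.
have [fs fsP fsE] := lift_leading_coefs csD.
have [s sI sP] := bounded_degree_gen D.
exists (s ++ fs) => p; apply/idP/idP; last first.
  by apply: gen_sub => // f; rewrite mem_cat => /orP[/sI|/fsP[]].
have [n] := ubnP (size p); elim: n p => // n IH p; rewrite ltnS => pn pI.
have [pD|Dp] := leqP (size p) D.
  apply/gen_catP; exists p; first exact: sP.
  by rewrite subrr (lin0 (gen_lin _)).
pose d := (size p).-1; have szp : size p = d.+1 by rewrite prednK //; lia.
have Dd : (D <= d)%N by rewrite -ltnS -szp.
have : p`_d \in gen_ideal [seq (f : {poly A})`_D | f <- fs].
  by rewrite fsE -csE; apply/asboolP; exists d; apply/asboolP; exists p; rewrite szp.
case/gen_leading_coef => [f /fsP[]//|q qfs [szq qD]].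
pose q' := q * 'X^(d - D).
have q'fs : q' \in gen_ideal (s ++ fs).
  apply: linMr; first exact: gen_lin.
  by apply: gen_mono qfs => f; rewrite mem_cat orbC => ->.
have q'I : q' \in I.
  by apply: linMr => //; apply: gen_sub qfs => // f /fsP[].
have szq' : (size q' <= d.+1)%N.
  rewrite (leq_trans (size_polyMleq _ _)) // size_polyXn; lia.
have q'D : q'`_d = p`_d by rewrite coefMXn ltnNge leq_subr subKn.
rewrite -[p](subrK q') linD //; first exact: gen_lin.
apply: IH; last exact: linB.
apply: leq_ltn_trans (size_sub_lead _ szq' _) _; rewrite ?szp //.
by rewrite -szp.
Qed.

End HilbertBasis.

Lemma noetherian_poly A : noetherian A -> noetherian {poly A}.
Proof. by move=> nA I /idealr_linear; apply: hilbert_basis. Qed.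

End Noetherian.

(** * Rings generated by finitely many elements *)

Section Generators.
Variable S : comNzRingType.
Implicit Types (l : seq S).

Definition poly_eval (A : comNzRingType) (iota : {rmorphism A -> S}) (x : S) :
  {rmorphism {poly A} -> S} := horner_morph (fun a => mulrC x (iota a)).

Lemma poly_evalE (A : comNzRingType) (iota : {rmorphism A -> S}) x p :
  poly_eval iota x p = (map_poly iota p).[x].
Proof. by []. Qed.

Lemma poly_evalC (A : comNzRingType) (iota : {rmorphism A -> S}) x a : poly_eval iota x a%:P = iota a.
Proof. by rewrite poly_evalE map_polyC hornerC. Qed.

Lemma poly_evalX (A : comNzRingType) (iota : {rmorphism A -> S}) x : poly_eval iota x 'X = x.
Proof. by rewrite poly_evalE map_polyX hornerX. Qed.

(** Generation as an induction principle: it passes from [A] with [x :: l] to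
[{poly A}] with [l], so that proofs by induction on [l] can vary the ring of
coefficients. *)
Definition generated_by (A : comNzRingType) (iota : {rmorphism A -> S}) l : Prop :=
  forall P : S -> Prop,
    (forall a, P (iota a)) -> (forall x, x \in l -> P x) ->
    (forall x y, P x -> P y -> P (x + y)) -> (forall x y, P x -> P y -> P (x * y)) ->
  forall x, P x.

Lemma generated_nil (A : comNzRingType) (iota : {rmorphism A -> S}) :
  generated_by iota [::] -> forall y, exists x, iota x = y.
Proof.
apply=> [a|//|_ _ [x <-] [y <-]|_ _ [x <-] [y <-]]; first by exists a.
  by exists (x + y); rewrite rmorphD.
by exists (x * y); rewrite rmorphM.
Qed.

Lemma generated_cons (A : comNzRingType) (iota : {rmorphism A -> S}) x l :
  generated_by iota (x :: l) -> generated_by (poly_eval iota x) l.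
Proof.
move=> gen P Pev Pl PD PM; apply: gen => // [a|y].
  by rewrite -(poly_evalC iota x).
rewrite inE => /predU1P[->|/Pl//].
by rewrite -[x](poly_evalX iota).
Qed.

Lemma generated_noetherian (A : comNzRingType) (iota : {rmorphism A -> S}) l :
  noetherian A -> generated_by iota l -> noetherian S.
Proof.
elim: l A iota => [|x l IH] A iota nA gen.
  exact: noetherian_surj (generated_nil gen) nA.
exact: IH (noetherian_poly nA) (generated_cons gen).
Qed.

End Generators.
(** * Fields that are finitely generated as rings over a field *)

Section Zariski.
Variable L : fieldType.

(** The image of [A] in [L] is a G-domain: inverting the image of the single
element [b] turns it into a field. *)
Definition field_after_one_inversion (A : comNzRingType) (iota : {rmorphism A -> L}) : Prop :=
  exists2 b, iota b != 0 &
    forall c, iota c != 0 -> exists d k, iota (c * d) = iota b ^+ k.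

Section Descent.
Variables (A : comNzRingType) (iota : {rmorphism A -> L}) (x : L).
Local Notation ev := (poly_eval iota x).
Implicit Types (p q c d : {poly A}).

(** Otherwise [ev] would identify the image of [iota] adjoined [x] with a
polynomial ring, in which [1 + b * 'X] cannot divide a power of [b]. *)
Lemma one_inversion_algebraic : field_after_one_inversion ev ->
  exists2 q, map_poly iota q != 0 & ev q = 0.
Proof.
case=> b b0 bP; apply: contrapT => tr.
have ev_inj p : ev p = 0 -> map_poly iota p = 0.
  by move=> p0; apply/eqP/negPn/negP => np; apply: tr; exists p.
have B0 : map_poly iota b != 0.
  by apply: contra_neq b0; rewrite poly_evalE => ->; rewrite horner0.
set B := map_poly iota b in B0.
have eE : map_poly iota (1 + b * 'X) = B * 'X + 1%:P.
  by rewrite rmorphD rmorphM rmorph1 /= map_polyX addrC.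
have sz : size (B * 'X + 1%:P) = (size B).+1 by rewrite size_MXaddC (negbTE B0).
have e0 : ev (1 + b * 'X) != 0.
  by apply/eqP => /ev_inj /eqP; rewrite eE -size_poly_eq0 sz.
have [d [k e]] := bP _ e0.
have : ev ((1 + b * 'X) * d - b ^+ k) = 0 by rewrite rmorphB rmorphXn e subrr.
move/ev_inj; rewrite rmorphB rmorphM rmorphXn /= eE -/B => /eqP.
rewrite subr_eq0 => /eqP dvd.
have cop : coprimep (B * 'X + 1%:P) (B ^+ k).
  apply: coprimep_expr; apply/Bezout_eq1_coprimepP; exists (1, - 'X) => /=.
  by rewrite mul1r mulNr [X in _ - X]mulrC addrAC subrr add0r.
have : B * 'X + 1%:P %= 1.
  by move/coprimepP: cop; apply; rewrite ?dvdpp // -dvd dvdp_mulr.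
rewrite -size_poly_eq1 sz eqSS size_poly_eq0; exact/negP.
Qed.

(** The denominator is the leading coefficient [b] of an equation of [x]: an
equation of degree [n] becomes monic in [b * x] when multiplied by
[b ^+ n.-1]. *)
Lemma denominator_integral q : map_poly iota q != 0 -> ev q = 0 ->
  exists2 b, iota b != 0 & integralOver iota (iota b * x).
Proof.
set Q := map_poly iota q => Q0 qx; pose n := (size Q).-1.
have szQ : size Q = n.+1 by rewrite prednK // size_poly_gt0.
have bE : iota q`_n = lead_coef Q by rewrite lead_coefE -coef_map.
exists q`_n; first by rewrite bE lead_coef_eq0.
have n0 : (0 < n)%N.
  rewrite lt0n; apply: contraNneq Q0 => n0.
  move: qx; rewrite poly_evalE -/Q.
  by rewrite [Q]size1_polyC ?szQ ?n0 // hornerC => ->.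
exists ('X^n + \poly_(i < n) (q`_i * q`_n ^+ (n.-1 - i))).
  rewrite monicE lead_coefDl ?lead_coefXn // size_polyXn ltnS.
  exact: size_poly.
rewrite /root rmorphD /= map_polyXn hornerD hornerXn.
have -> : map_poly iota (\poly_(i < n) (q`_i * q`_n ^+ (n.-1 - i))) =
    \poly_(i < n) (Q`_i * iota q`_n ^+ (n.-1 - i)).
  apply/polyP => i; rewrite coef_map !(coef_poly n).
  by case: (i < n)%N; rewrite /= ?rmorph0 // rmorphM rmorphXn /Q coef_map.
rewrite horner_poly.
have -> : (iota q`_n * x) ^+ n = iota q`_n ^+ n.-1 * (Q`_n * x ^+ n).
  by rewrite exprMn mulrA coef_map -exprSr prednK.
have -> : \sum_(i < n) Q`_i * iota q`_n ^+ (n.-1 - i) * (iota q`_n * x) ^+ i =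
    iota q`_n ^+ n.-1 * \sum_(i < n) Q`_i * x ^+ i.
  rewrite mulr_sumr; apply: eq_bigr => i _; rewrite exprMn.
  have i_n : (i <= n.-1)%N by rewrite -ltnS prednK.
  by rewrite -{2}(subnK i_n) exprD; ring.
move: qx; rewrite poly_evalE horner_coef -/Q szQ big_ord_recr /= => qx.
by rewrite -mulrDr addrC qx mulr0.
Qed.

Lemma integral_pow (u : L) i : integralOver iota u -> integralOver iota (u ^+ i).
Proof.
move=> iu; elim: i => [|i IH]; first exact: integral1.
by rewrite exprS; apply: integral_mul.
Qed.

Lemma multiple_integral b p : integralOver iota (iota b * x) ->
  exists j, integralOver iota (iota b ^+ j * ev p).
Proof.
move=> bx; exists (size p); rewrite poly_evalE (horner_coef_wide _ (size_poly _ _)).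
rewrite mulr_sumr; elim/big_ind: _ => [||i _]; [exact: integral0|exact: integral_add|].
have -> : iota b ^+ size p * ((map_poly iota p)`_i * x ^+ i) =
    iota (p`_i * b ^+ (size p - i)) * (iota b * x) ^+ i.
  rewrite coef_map rmorphM rmorphXn exprMn -{1}(subnK (ltnW (ltn_ord i))) exprD.
  by rewrite /=; ring.
by apply: integral_mul; [exact: integral_id|exact: integral_pow].
Qed.

Lemma root_constant_coef p z : z != 0 -> map_poly iota p != 0 ->
    root (map_poly iota p) z ->
  exists2 p' : {poly A}, iota p'`_0 != 0 & root (map_poly iota p') z.
Proof.
move=> z0; elim/poly_ind: p => [|p c IH]; first by rewrite rmorph0 eqxx.
have [c0|c0] := eqVneq (iota c) 0; last first.
  move=> _ pz; exists (p * 'X + c%:P) => //.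
  by rewrite coefD coefMX coefC add0r.
rewrite rmorphD rmorphM /= map_polyX map_polyC /= c0 addr0 => p0.
rewrite rootM [X in _ || X](_ : _ = false) ?orbF; last by rewrite rootE hornerX (negbTE z0).
by apply: IH; apply: contraNneq p0 => ->; rewrite mul0r.
Qed.

(** With [b] a denominator of [x], every member of the extension becomes
integral over [A] after multiplication by a power of [b]. An equation of the
inverted element of the extension gives an element of [A] that it divides, and
an equation for the inverse of [c] gives a power that [c] divides. *)
Lemma one_inversion_descent :
  field_after_one_inversion ev -> field_after_one_inversion iota.
Proof.
move=> inv; have [q q0 qx] := one_inversion_algebraic inv.
have [b b0 bx] := denominator_integral q0 qx.
case: inv => y y0 yP.
have [j [chi chi_mon]] := multiple_integral y bx.
have z0 : iota b ^+ j * ev y != 0 by rewrite mulf_neq0 ?expf_neq0.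
case/(root_constant_coef z0) => [|p0' ].
  by rewrite monic_neq0 ?monic_map.
elim/poly_ind: p0' => [|p g _]; first by rewrite coef0 rmorph0 eqxx.
rewrite coefD coefMX coefC add0r /= => g0.
rewrite rootE rmorphD rmorphM /= map_polyX map_polyC hornerD hornerMX hornerC.
set z := _ * ev y in z0 *; rewrite addr_eq0 => /eqP gE.
have pE : (map_poly iota p).[z] = ev (map_poly polyC p).[b%:P ^+ j * y].
  rewrite -horner_map -map_poly_comp (eq_map_poly (g := iota)) => [|c].
    by rewrite rmorphM rmorphXn poly_evalC.
  exact: poly_evalC.
pose w := - ((map_poly polyC p).[b%:P ^+ j * y] * b%:P ^+ j).
have wE : iota g = ev y * ev w.
  rewrite -[iota g]opprK -gE pE /w rmorphN rmorphM rmorphXn poly_evalC /z.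
  by rewrite mulrN [X in _ = - X]mulrC mulrA.
exists (b * g); first by rewrite rmorphM mulf_neq0.
move=> c c0; have [|d [k dE]] := yP c%:P; first by rewrite poly_evalC.
pose u := ev (d * w ^+ k).
have uE : iota c * u = iota g ^+ k.
  by rewrite /u rmorphM mulrA -(poly_evalC iota x c) -rmorphM dE wE exprMn rmorphXn.
have [j' [psi psi_mon]] := multiple_integral (d * w ^+ k) bx.
rewrite -/u => /rootP psi0; pose n := (size psi).-1.
have szpsi : size psi = n.+1 by rewrite prednK // size_poly_gt0 monic_neq0.
pose h := b ^+ j' * g ^+ k.
have hE : iota h = iota c * (iota b ^+ j' * u).
  by rewrite /h rmorphM !rmorphXn -uE; ring.
have hn : iota h ^+ n = iota c * - iota (\sum_(i < n) psi`_i * c ^+ (n.-1 - i) * h ^+ i).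
  apply/eqP; rewrite mulrN -addr_eq0 addrC; apply/eqP.
  have /(congr1 (fun v => iota c ^+ n * v)) := psi0; rewrite mulr0.
  rewrite (@horner_coef_wide _ n.+1) -?szpsi ?size_poly // szpsi big_ord_recr /=.
  rewrite coef_map /= -[n in psi`_n]/(size psi).-1 -lead_coefE (monicP psi_mon) (rmorph1 iota) mul1r.
  rewrite mulrDr -exprMn -hE => e; rewrite -[RHS]e; congr (_ + _).
  rewrite rmorph_sum !mulr_sumr; apply: eq_bigr => i _.
  rewrite coef_map !rmorphM !rmorphXn /= hE !exprMn.
  have i_n : n = (n.-1 - i + i).+1.
    by rewrite subnK ?prednK //; have := ltn_ord i; lia.
  by rewrite [X in iota c ^+ X * _]i_n exprS exprD; ring.
exists (- (\sum_(i < n) psi`_i * c ^+ (n.-1 - i) * h ^+ i) * (b ^+ (k * n) * g ^+ (j' * n))).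
exists ((j' + k) * n)%N.
rewrite mulrA rmorphM rmorphM rmorphN -hn /h !rmorphM !rmorphXn exprMn -!exprM.
by rewrite exprMn mulnDl !exprD; ring.
Qed.

End Descent.

Lemma generated_one_inversion (A : comNzRingType) (iota : {rmorphism A -> L}) l :
  generated_by iota l -> field_after_one_inversion iota.
Proof.
elim: l A iota => [|x l IH] A iota gen.
  exists 1 => [|c c0]; first by rewrite rmorph1 oner_eq0.
  have [d dE] := generated_nil gen (iota c)^-1.
  by exists d, 0%N; rewrite expr0 rmorphM dE mulfV.
exact: one_inversion_descent (IH _ _ (generated_cons gen)).
Qed.

(** Adjoining [x] first, before the generators, exhibits the image of
[{poly K}] under evaluation at [x] as a G-domain. *)
Lemma generated_algebraic (K : fieldType) (kap : {rmorphism K -> L}) l x :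
  generated_by kap l -> exists2 p : {poly K}, p != 0 & (map_poly kap p).[x] = 0.
Proof.
move=> gen; have [|p p0 px] := @one_inversion_algebraic K kap x.
  apply: (@generated_one_inversion _ _ l).
  move=> P Pev Pl PD PM; apply: gen => // a.
  by rewrite -(poly_evalC kap x).
by exists p => //; apply: contraNneq p0 => ->; rewrite rmorph0.
Qed.

End Zariski.
(** * Regular sequences in towers of monic equations *)

Section Transport.
Variables S T : comNzRingType.

Lemma weakly_regular_retract (Phi : {rmorphism S -> T}) (Psi : {rmorphism T -> S}) (s : seq S) :
  cancel Phi Psi -> weakly_regular (map Phi s) -> weakly_regular s.
Proof.
move=> PhiK reg i r ilt h.
have := reg i (Phi r); rewrite size_map (nth_map 0) // -rmorphM -map_take => /(_ ilt).
move=> /(_ (gen_map Phi h))/(gen_map Psi); rewrite PhiK -map_comp.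
by rewrite (eq_map (g := id)) ?map_id.
Qed.

Lemma weakly_regular_quotient (pi : {rmorphism S -> T}) (s0 s : seq S) :
    (forall y, exists x, pi x = y) -> (forall x, (pi x == 0) = (x \in gen_ideal s0)) ->
  weakly_regular (s0 ++ s) -> weakly_regular (map pi s).
Proof.
move=> surj ker reg i y; rewrite size_map => ilt; have [t <-] := surj y.
rewrite (nth_map 0) // -rmorphM -map_take => /(gen_map_surj surj)[u us /eqP].
rewrite -subr_eq0 -rmorphB ker => h.
have st : s`_i * t \in gen_ideal (s0 ++ take i s).
  apply/gen_catP; exists (s`_i * t - u); last by rewrite opprB addrC subrK.
  by rewrite -opprB; apply: linN => //; apply: gen_lin.
have := reg (size s0 + i)%N t; rewrite size_cat ltn_add2l => /(_ ilt).
rewrite nth_cat ltnNge leq_addr addKn take_cat ltnNge leq_addr addKn /=.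
case/(_ st)/gen_catP => a; rewrite -ker => /eqP a0 ta.
by rewrite -[t](subrK a) rmorphD a0 addr0; apply: gen_map.
Qed.

End Transport.

Section MonicExtension.
Variables (A : comNzRingType) (f : {poly A}).
Hypothesis f_monic : f \is monic.
Implicit Types (s : seq A) (u w : {poly A}).
Import Pdiv.CommonRing Pdiv.RingMonic.

Lemma gen_polyC s u :
  u \in gen_ideal (map polyC s) <-> forall k, u`_k \in gen_ideal s.
Proof.
split=> [|us].
  elim: s u => [|a s IH] u; first by rewrite gen_nil => /eqP -> k; rewrite coef0 gen_nil.
  case/gen_consP => c /IH h k; apply/gen_consP; exists c`_k.
  by have := h k; rewrite coefB coefMC.
rewrite -[u]coefK poly_def; apply: lin_sum => [|i _]; first exact: gen_lin.
by rewrite -mul_polyC; apply: linMr; [exact: gen_lin|apply: gen_map].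
Qed.

Lemma gen_rmodp s w : w \in gen_ideal (map polyC s) -> rmodp w f \in gen_ideal (map polyC s).
Proof.
elim: s w => [|a s IH] w; first by rewrite !gen_nil => /eqP ->; rewrite rmod0p.
case/gen_consP => c /IH h; apply/gen_consP; exists (rmodp c f).
by rewrite mulrC mul_polyC -(rmodpZ f_monic) -(rmodpB f_monic) -mul_polyC mulrC.
Qed.

(** Modulo a monic polynomial, [{poly A}] is a free module over [A]. *)
Lemma weakly_regular_monic s : weakly_regular s -> weakly_regular (f :: map polyC s).
Proof.
move=> reg [|i] r.
  rewrite !gen_nil /= mulrC => _ /eqP rf.
  by rewrite -(rdivp_mull f_monic r) rf rdiv0p.
rewrite /= ltnS size_map => ilt; rewrite (nth_map 0) // -map_take.
case/gen_consP => a /gen_rmodp.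
rewrite (rmodpB f_monic) (rmodp_mull f_monic) subr0 mul_polyC (rmodpZ f_monic).
move/gen_polyC => h; apply/gen_consP; exists (rdivp r f).
rewrite {1}(rdivp_eq f_monic r) addrC addKr; apply/gen_polyC => k.
by apply: reg => //; rewrite -coefZ.
Qed.

End MonicExtension.

(** A polynomial ring in which [nth 0 theta i] has been adjoined as a variable
for each member of [ps]; only its universal property is recorded. *)
Lemma separate_variables_regular (K : fieldType) (ps : seq {poly K}) :
    (forall p, p \in ps -> p \is monic) ->
  exists (A : comNzRingType) (kap : {rmorphism K -> A}) (theta : seq A),
    [/\ size theta = size ps,
        weakly_regular [seq (map_poly kap q.1).[q.2] | q <- zip ps theta]
      & forall (S : comNzRingType) (kap' : {rmorphism K -> S}) (xs : seq S),
          size xs = size ps -> exists2 Psi : {rmorphism A -> S},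
            (forall c, Psi (kap c) = kap' c) & map Psi theta = xs].
Proof.
elim: ps => [_|p ps IH mon].
  exists K, idfun, [::]; split=> // S kap' [] // _.
  by exists kap'.
have [|A [kap [theta [sz reg univ]]]] := IH.
  by move=> q qps; apply: mon; rewrite inE qps orbT.
exists {poly A}, (polyC \o kap), ('X :: map polyC theta); split.
- by rewrite /= size_map sz.
- rewrite /= [X in X :: _](_ : _ = map_poly kap p); last first.
    by rewrite map_poly_comp; apply: comp_polyXr.
  have -> : [seq (map_poly (polyC \o kap) q.1).[q.2] | q <- zip ps (map polyC theta)] =
      map polyC [seq (map_poly kap q.1).[q.2] | q <- zip ps theta].
    elim: (ps) (theta) => [|q qs IHq] [|t ts] //=.
    by rewrite IHq map_poly_comp horner_map.
  apply: weakly_regular_monic reg.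
  exact/monic_map/mon/mem_head.
- move=> S kap' [//|x xs] [szx]; have [Psi PsiK Psith] := univ S kap' xs szx.
  exists (poly_eval Psi x) => [c|] /=; first by rewrite (poly_evalC Psi x).
  rewrite (poly_evalX Psi x) -map_comp; congr (_ :: _).
  by rewrite -Psith; apply: eq_map => t; apply: (poly_evalC Psi x).
Qed.
(** * Two monomials without common variables give a Cohen--Macaulay ring *)

Lemma comring_field (Q : comNzRingType) :
    (forall x : Q, x != 0 -> exists y, y * x = 1) ->
  exists (L : fieldType) (f : {rmorphism Q -> L}),
    (forall y, exists x, f x = y) /\ (forall x, (f x == 0) = (x == 0)).
Proof.
move=> Qinv.
have [|inv invP] := @boolp.choice Q Q (fun x y => (x != 0 -> y * x = 1) /\ (x = 0 -> y = 0)).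
  move=> x; have [->|x0] := eqVneq x 0; first by exists 0.
  by have [y yx] := Qinv x x0; exists y; split=> // e; rewrite e eqxx in x0.
pose M := GRing.ComNzRing_isField.Build Q (fun x => (invP x).1) ((invP 0).2 erefl).
pose L : fieldType := HB.pack (GRing.ComNzRing.sort Q) M.
exists L, (@idfun Q : {rmorphism Q -> L}); split=> // y.
by exists y.
Qed.

Lemma residue_field (R : comNzRingType) (P : {pred R}) : maximal_ideal P ->
  exists (L : fieldType) (rho : {rmorphism R -> L}),
    (forall y, exists x, rho x = y) /\ (forall x, (rho x == 0) = (x \in P)).
Proof.
case=> Pid Pmax; have Pl := idealr_linear Pid.
pose MI := isIdealr.Build R P Pid.
pose P' : idealr R := HB.pack P MI.
have [pi [pi_surj pi_ker]] := ideal_quotient_map P'.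
have [|L [f [f_surj f_ker]]] := @comring_field {ideal_quot P'}.
  move=> x; have [t <-] := pi_surj x; rewrite pi_ker => tP.
  pose I : {pred R} := fun u => `[< exists a, u - a * t \in P >].
  have Il : linear_pred I.
    split=> [|a u v /asboolP[b bP] /asboolP[c cP]]; apply/asboolP.
      by exists 0; rewrite mul0r subr0 (lin0 Pl).
    exists (a * b + c); rewrite (_ : _ - _ = a * (u - b * t) + (v - c * t)); last by ring.
    exact: Pl.2.
  have [/asboolP[a aP]|I1] := boolP (1 \in I).
    exists (pi a); rewrite -rmorphM; apply/eqP.
    by rewrite eq_sym -subr_eq0 -(rmorph1 pi) -rmorphB pi_ker.
  case/negP: tP; apply: (Pmax I); first exact: linear_idealr.
    by move=> u uP; apply/asboolP; exists 0; rewrite mul0r subr0.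
  by apply/asboolP; exists 1; rewrite mul1r subrr (lin0 Pl).
exists L, (f \o pi); split=> [y|x]; last by rewrite /= f_ker pi_ker.
have [x <-] := f_surj y; have [t <-] := pi_surj x.
by exists t.
Qed.

Lemma mpoly_generated (K : fieldType) (N : nat) (T : comNzRingType)
    (phi : {rmorphism {mpoly K[N]} -> T}) :
  (forall y, exists x, phi x = y) ->
  generated_by (phi \o @mpolyC N K) [seq phi 'X_i | i <- enum 'I_N].
Proof.
move=> surj P PC PX PD PM y; have [t <-] := surj y.
rewrite [t]mpolyE rmorph_sum; elim/big_ind: _ => [||m _].
- by have := PC 0; rewrite rmorph0.
- exact: PD.
rewrite -mul_mpolyC rmorphM; apply: (PM); first exact: PC.
rewrite mpolyXE_id rmorph_prod; elim/big_ind: _ => [||i _].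
- by have := PC 1; rewrite rmorph1.
- exact: PM.
rewrite rmorphXn; elim: (m i) => [|k IH]; first by have := PC 1; rewrite rmorph1.
by rewrite exprS; apply: (PM) => //; apply: PX; apply/mapP; exists i; rewrite ?mem_enum.
Qed.

Lemma prime_chain_le (R : comNzRingType) (P : {pred R}) k k' :
  (k <= k')%N -> prime_chain P k' -> prime_chain P k.
Proof.
move=> kk' [Q [Qpr Qlt QP]]; exists (fun i => Q (i + (k' - k))%N); split=> [i ik|i ik|].
- by apply: Qpr; lia.
- by apply: (Qlt (i + (k' - k))%N); lia.
- by rewrite subnKC.
Qed.

Section TwoMonomialsRegular.
Variables (K : fieldType) (N : nat) (F G : {set 'I_N}) (v w : 'I_N).
Hypotheses (FG : [disjoint F & G]) (vF : v \in F) (wG : w \in G).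
Local Notation S := {mpoly K[N]}.

Let vw : v != w. Proof. by apply: contraTneq wG => <-; rewrite (disjointFr FG). Qed.

Let base i := if i \in F then v else w.
Let l := enum (~: [set v; w]).

(** In the coordinates ['X_v], ['X_w] and ['X_i - 'X_(base i)] the monomials
become monic in ['X_v] and in ['X_w] respectively, so the remaining
quotient by both is free as a module over the polynomial ring in the remaining
coordinates. There the [p i], in separate variables, form a regular sequence. *)
Lemma two_monomials_regular (p : 'I_N -> {poly K}) :
    (forall i, p i \is monic) ->
  weakly_regular ([:: mon K F; mon K G] ++
    [seq (map_poly (@mpolyC N K) (p i)).['X_i - 'X_(base i)] | i <- l]).
Proof.
move=> p_monic.
have [|A [kap [theta [sz reg univ]]]] := @separate_variables_regular K (map p l).
  by move=> _ /mapP[i _ ->].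
rewrite size_map in sz univ.
have ul : uniq l by apply: enum_uniq.
pose th i := theta`_(index i l).
have thE : theta = map th l.
  apply: (@eq_from_nth _ 0) => [|j]; rewrite ?size_map // sz => jl.
  by rewrite (nth_map v) // /th index_uniq.
pose h i : {poly {poly A}} := if i == v then 'X else if i == w then 'X%:P else
  (th i)%:P%:P + (if i \in F then 'X else 'X%:P).
pose kap2 : {rmorphism K -> {poly {poly A}}} := (@polyC {poly A} \o @polyC A) \o kap.
pose Phi : {rmorphism S -> {poly {poly A}}} := mmap kap2 h.
have PhiC c : Phi c%:MP = kap2 c by rewrite /Phi /= mmapC.
have PhiX i : Phi 'X_i = h i by rewrite /Phi /= mmapX mmap1U.
have [|Psi0 Psi0C Psi0th] := univ S (@mpolyC N K) [seq 'X_i - 'X_(base i) | i <- l].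
  by rewrite size_map.
pose Psi := poly_eval (poly_eval Psi0 'X_w) 'X_v.
have PsiC a : Psi a%:P%:P = Psi0 a by rewrite /Psi !poly_evalC.
have PsiX : Psi 'X = 'X_v by rewrite /Psi poly_evalX.
have PsiY : Psi 'X%:P = 'X_w by rewrite /Psi poly_evalC poly_evalX.
have in_l i : (i \in l) = (i != v) && (i != w).
  by rewrite mem_enum !inE negb_or.
have Psi0E i : i \in l -> Psi0 (th i) = 'X_i - 'X_(base i).
  by move: Psi0th; rewrite thE -map_comp => /eq_in_map; apply.
have PhiK : cancel Phi Psi.
  move=> t; have -> : t = (idfun : {rmorphism S -> S}) t by [].
  have : Psi \o Phi =1 (idfun : {rmorphism S -> S}); last by apply.
  apply: mpoly_rmorph_ext => [c|i] /=.
    by rewrite [X in poly_eval _ _ X]PhiC [LHS]PsiC Psi0C.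
  rewrite [X in poly_eval _ _ X]PhiX /h.
  case: (eqVneq i v) => [->|iv]; first exact: PsiX.
  case: (eqVneq i w) => [->|iw]; first exact: PsiY.
  rewrite rmorphD [X in X + _]PsiC Psi0E ?in_l ?iv // /base.
  by case: ifP => _; [rewrite [X in _ + X]PsiX|rewrite [X in _ + X]PsiY]; rewrite subrK.
apply: (weakly_regular_retract PhiK); rewrite map_cat /= -map_comp.
pose g : {poly A} := \prod_(i in G) (if i == w then 'X else (th i)%:P + 'X).
have monX (c : {poly A}) : c%:P + 'X \is monic.
  by rewrite addrC monicXaddC.
have -> : Phi (mon K G) = g%:P.
  rewrite /mon /g rmorph_prod rmorph_prod; apply: eq_bigr => i iG.
  rewrite [LHS]PhiX /h; have [iv|_] := eqVneq i v.
    by move: (disjointFr FG vF); rewrite -iv iG.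
  by case: ifP => // _; rewrite (disjointFl FG iG) rmorphD.
have -> : [seq (Phi \o (fun i => (map_poly (@mpolyC N K) (p i)).['X_i - 'X_(base i)])) i | i <- l] =
    map polyC (map polyC [seq (map_poly kap q.1).[q.2] | q <- zip (map p l) theta]).
  rewrite thE zip_map -!map_comp; apply/eq_in_map => i; rewrite in_l => /andP[iv iw] /=.
  rewrite -horner_map -map_poly_comp rmorphB (eq_map_poly (g := kap2)) //.
  rewrite (PhiX i) (PhiX (base i)) /h (negbTE iv) (negbTE iw) /base.
  rewrite -!horner_map -!map_poly_comp.
  case: ifP => _; rewrite eqxx.
    by rewrite addrK.
  by rewrite eq_sym (negbTE vw) addrK.
apply: (@weakly_regular_monic _ _ _ (g :: map polyC _)); last first.
  apply: weakly_regular_monic reg.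
  apply: monic_prod => i _; case: ifP => _; first exact: monicX.
  by rewrite addrC monicXaddC.
rewrite rmorph_prod; apply: monic_prod => i iF; rewrite [X in X \is _]PhiX /h iF.
have [e|iw] := eqVneq i w; first by have := disjointFl FG wG; rewrite -e iF.
by case: ifP => _; [exact: monicX|exact: monX].
Qed.

End TwoMonomialsRegular.

Section TwoMonomialsCM.
Variables (K : fieldType) (N : nat) (F G : {set 'I_N}).
Hypotheses (FG : [disjoint F & G]) (F0 : F != set0) (G0 : G != set0).
Local Notation S := {mpoly K[N]}.
Variables (R : comNzRingType) (pi : {rmorphism S -> R}).
Hypotheses (pi_surj : forall x, exists t, pi t = x)
  (pi_ker : forall t, (pi t == 0) = (t \in gen_ideal [:: mon K F; mon K G])).

Let relation (r : seq R) : (size r).+1 = N ->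
  exists t c, (exists2 e, e \in exponents t r & c e != 0) /\
    poly_value (pi \o @mpolyC N K) t c r = 0.
Proof.
have [sec secK] := boolp.choice pi_surj; move=> szr.
have rsK : map pi (map sec r) = r by rewrite -map_comp map_id_in // => x _ /=.
have [|t [c [[e he ce] c0]]] := two_monomials_relation FG F0 G0 (r := map sec r).
  by rewrite size_map.
exists t, c; split; first by exists e; rewrite // inE -(size_map sec).
by apply/eqP; rewrite -[X in poly_value _ _ _ X]rsK -poly_value_map pi_ker.
Qed.

(** Any [N - 1] elements satisfy a relation, which bounds both the height and
the depth. Conversely the coordinates of a closed point are algebraic. Those
of some [v] in [F] and some [w] in [G] vanish; freeing the others gives a chain
of primes, and their equations give a regular sequence. *)
Lemma two_monomials_cohen_macaulay : cohen_macaulay R.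
Proof.
split.
  exact: generated_noetherian (@noetherian_field K) (mpoly_generated pi_surj).
move=> P Pmax; have [L [rho [rho_surj rhoP]]] := residue_field Pmax.
pose phi : {rmorphism S -> L} := rho \o pi.
have phi_surj y : exists t, phi t = y.
  by have [x <-] := rho_surj y; have [t <-] := pi_surj x; exists t.
pose kap : {rmorphism K -> L} := phi \o @mpolyC N K.
pose a i := phi 'X_i.
have phiE t : phi t = point_eval kap a t.
  by apply: mpoly_rmorph_ext => [c|i]; rewrite /point_eval /= ?mmapC ?mmapX ?mmap1U.
have PE t : (pi t \in P) = (point_eval kap a t == 0) by rewrite -phiE /phi /= rhoP.
have alg i : exists2 p : {poly K}, p != 0 & (map_poly kap p).[a i] = 0.
  exact: generated_algebraic (mpoly_generated phi_surj).
have zero_coord E : mon K E \in [:: mon K F; mon K G] -> exists2 i, i \in E & a i = 0.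
  move=> hE; have : phi (mon K E) == 0.
    by rewrite /phi /= (eqP (_ : pi (mon K E) == 0)) ?rmorph0 // pi_ker; apply: gen_mem.
  rewrite /mon rmorph_prod; case/prodf_eq0 => i iE /eqP ai; by exists i.
have [v vF av] := zero_coord F (mem_head _ _).
have [w wG aw] : exists2 i, i \in G & a i = 0 by apply: zero_coord; rewrite !inE eqxx orbT.
have vw : v != w by apply: contraTneq wG => <-; rewrite (disjointFr FG).
have [/idealr_linear Pl _] := Pmax.
have P1 : 1 \notin P by case: Pmax => -[].
pose l := enum (~: [set v; w]).
have szl : size l = (N - 2)%N by rewrite -cardE cardsCs setCK cards2 vw card_ord.
have N2 : (2 <= N)%N.
  by have := max_card [set v; w]; rewrite cards2 vw card_ord.
have chain : prime_chain P (N - 2).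
  have <- : #|[set v; w]| = 2%N by rewrite cards2 vw.
  apply: (point_chain pi_surj _ alg PE) => t /eqP; rewrite pi_ker.
  pose I : {pred S} := [pred t | specialization kap a [set v; w] t == 0].
  have Il : linear_pred I by apply/idealr_linear/(kernel_prime (specialization kap a [set v; w])).1.
  have mon0 (E : {set 'I_N}) i : i \in E -> i \in [set v; w] -> a i = 0 -> mon K E \in I.
    move=> iE iD ai; rewrite inE /mon rmorph_prod (bigD1 i) //=.
    by rewrite specializationX iD ai mpolyC0 mul0r.
  move=> tI; apply/eqP; apply: (gen_sub Il _ tI) => E'.
  rewrite !inE => /orP[]/eqP ->; [apply: (mon0 _ v)|apply: (mon0 _ w)];
    by rewrite ?inE ?eqxx ?orbT.
have [p pP] : exists p : 'I_N -> {poly K},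
    forall i, p i \is monic /\ (map_poly kap (p i)).[a i] = 0.
  have [i|p pP] := @boolp.choice 'I_N {poly K} (fun i q =>
    q \is monic /\ (map_poly kap q).[a i] = 0); last by exists p.
  have [q q0 qi] := alg i; exists ((lead_coef q)^-1 *: q); split.
    by rewrite monicE lead_coefZ mulVf ?lead_coef_eq0.
  by rewrite map_polyZ hornerZ qi mulr0.
pose rr i : S := (map_poly (@mpolyC N K) (p i)).['X_i - 'X_(if i \in F then v else w)].
have rrP i : pi (rr i) \in P.
  have evX j : point_eval kap a 'X_j = a j by rewrite /point_eval /= mmapX mmap1U.
  rewrite PE /rr -horner_map -map_poly_comp (eq_map_poly (g := kap)) => [|c].
    rewrite rmorphB (evX i) (evX (if _ then _ else _)).
    by rewrite (_ : a (if _ then _ else _) = 0) ?subr0 ?(pP i).2 //; case: ifP.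
  by rewrite /point_eval /= mmapC.
have rrsub : {subset map pi (map rr l) <= P}.
  by move=> _ /mapP[_ /mapP[i _ ->] ->].
exists (N - 2)%N; split; split.
- exists (map pi (map rr l)); split=> //; first by rewrite !size_map.
  split; first by apply: contra P1; apply: gen_sub.
  apply: (weakly_regular_quotient pi_surj pi_ker).
  by apply: two_monomials_regular => // i; case: (pP i).
- move=> s sP [s1 sreg]; rewrite leqNgt; apply/negP => Ns.
  have szs : size (take (N - 1) s) = (N - 1)%N by rewrite size_takel //; lia.
  have [|t [c [nz c0]]] := relation (r := take (N - 1) s); first by rewrite szs; lia.
  case/negP: s1; apply: (@gen_mono _ (take (N - 1) s)); first by move=> x /mem_take.
  apply: (regular_relation (kap := pi \o @mpolyC N K) (weakly_regular_take sreg) nz).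
  by rewrite c0 mul0r.
- exact: chain.
- move=> k kP; rewrite leqNgt; apply/negP => Nk.
  have kP' : prime_chain P (N - 1) by apply: prime_chain_le kP; lia.
  apply: (prime_chain_relation (kap := pi \o @mpolyC N K) kP') => r szr.
  by apply: relation; rewrite szr; lia.
Qed.

End TwoMonomialsCM.

(** * Double brooms whose handle has four vertices *)

Lemma mon_mul (K : fieldType) N (E E' : {set 'I_N}) :
  E \subset E' -> exists p, mon K E' = p * mon K E.
Proof.
move=> EE'; rewrite (monE K E'); apply: mon_dvd; apply/subsetP => i /(subsetP EE').
by rewrite inE mnmE => ->.
Qed.

Lemma NI_cohen_macaulay (K : fieldType) (V : finType) (e : rel V) (u1 u2 : V) :
    [disjoint closed_neighborhood e u1 & closed_neighborhood e u2] ->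
    (forall u, (closed_neighborhood e u1 \subset closed_neighborhood e u) ||
               (closed_neighborhood e u2 \subset closed_neighborhood e u)) ->
  cohen_macaulay_ideal (NI K e).
Proof.
move=> dis nb; have [pi [pi_surj pi_ker]] := ideal_quotient_map (NI K e).
pose F := enum_rank @: closed_neighborhood e u1.
pose G := enum_rank @: closed_neighborhood e u2.
apply: (@two_monomials_cohen_macaulay K _ F G _ _ _ _ pi pi_surj).
- by rewrite /F /G imset_disjoint //; apply: enum_rank_inj.
- by apply/set0Pn; exists (enum_rank u1); rewrite imset_f // setU11.
- by apply/set0Pn; exists (enum_rank u2); rewrite imset_f // setU11.
move=> t; rewrite pi_ker NI_gen; apply/idP/idP; apply: gen_sub_gen.
  move=> _ /mapP[_ /mapP[u _ ->] ->].
  have [] := orP (nb u) => /(imsetS enum_rank)/(mon_mul K)[p ->];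
    apply: linMl; do ?exact: gen_lin; apply: gen_mem;
    by rewrite !inE eqxx ?orbT.
move=> f; rewrite !inE => /orP[]/eqP ->; apply/gen_mem/map_f/map_f;
  by rewrite mem_enum.
Qed.

Theorem corollary4p9 (K : fieldType) (n m s : nat)
    (hn : (2 <= n)%N) (hm : (2 <= m)%N) (hs : (2 <= s)%N) :
  cohen_macaulay_ideal (NI K (@double_broom_square n m s)) <-> m = 4%N.
Proof.
have n0 : (0 < n)%N by apply: ltnW.
have s0 : (0 < s)%N by apply: ltnW.
split=> [CM|m4].
  apply: contrapT => m4; have [m3|m5] := leqP m 3.
    by apply: (short_handle_not_cohen_macaulay n0 s0 _ CM); rewrite hm.
  by apply: (long_handle_not_cohen_macaulay n0 s0 _ CM); lia.
rewrite m4 in hm *.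
apply: (@NI_cohen_macaulay _ _ _ (inl (Ordinal n0)) (inr (inr (Ordinal s0)))).
  apply/pred0P => v; rewrite /= !nbhdE.
  by case: v => [i|[i|i]] //=; lia.
case=> [i|[i|i]]; apply/orP; [left| |right]; last first.
- by apply/subsetP => v; rewrite !nbhdE.
- by case: (ltnP i 2) => i2; [left|right]; apply/subsetP => v;
    rewrite !nbhdE; case: v => [j|[j|j]] //=;
    have := ltn_ord i; have := ltn_ord j; lia.
- by apply/subsetP => v; rewrite !nbhdE.
Qed.
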